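(* \begin{enumerate} \item $\mathrm{MILL}1$ is sound w.r.t. hypergraph language models. \item $\mathrm{MILL}1(\multimap,\forall)$ is complete w.r.t. hypergraph language models. \end{enumerate}
   Context: $\mathrm{MILL}1$ is first-order multiplicative intuitionistic linear logic (connectives $\otimes,\multimap$, quantifiers $\exists,\forall$, atomic formulae $p(x_1,\dots,x_n)$ with variables only, no function symbols or constants), with sequents $\Gamma\vdash B$, $\Gamma$ a multiset; $\mathrm{MILL}1(\multimap,\forall)$ is its fragment using only $\multimap$ and $\forall$. Selectors and variables are identified: $\Sigma=\mathrm{Var}$. A hypergraph $H$ over a $\Sigma$-typed alphabet $T$ has nodes $V_H$, hyperedges $E_H$ labelled by $T$, attachment functions $\mathit{att}_H(e):\mathrm{type}(\mathit{lab}_H(e))\to V_H$ and external-node function $\mathit{ext}_H:\mathrm{type}(H)\to V_H$; $K_0$ is the empty hypergraph. Parallel composition $H_1 \mathbin{/\!/} H_2$: disjoint union of $H_1,H_2$ with $\mathit{ext}_{H_1}(\sigma)$ and $\mathit{ext}_{H_2}(\sigma)$ fused for $\sigma\in\mathrm{type}(H_1)\cap\mathrm{type}(H_2)$; type $\mathrm{type}(H_1)\cup\mathrm{type}(H_2)$. Substitution $\mathit{sub}_h(H)$ for partial $h:\Sigma\to\Sigma$ fuses external nodes whose selectors have equal $h$-images and renames selectors via $h$ (selectors with undefined $h$ become non-external). A hypergraph language model is $\langle T,u\rangle$ with $u$ mapping $\mathrm{MILL}1$ formulae to sets of abstract hypergraphs over $T$ such that: $\mathit{sub}_h(u(A))\subseteq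 u(A[h])$ for any total $h:\Sigma\to\Sigma$; $u(A\otimes B)=u(A)\mathbin{/\!/} u(B)$; $u(A\multimap B)=\{H\mid\forall H'\in u(A)\,(H\mathbin{/\!/} H'\in u(B))\}$; $u(\exists xA)=\bigcup_{y}u(A[y/x])$; $u(\forall xA)=\bigcap_y u(A[y/x])$. A sequent $A_1,\ldots,A_n\vdash B$ is true in the model if $u(A_1)\mathbin{/\!/}\cdots\mathbin{/\!/} u(A_n)\subseteq u(B)$ (for $n=0$: $K_0\in u(B)$). *)

(* Defs.v *)
From HB Require Import structures.
From mathcomp Require Import all_boot finmap.
From Stdlib Require Import Permutation.

Set Implicit Arguments.
Unset Strict Implicit.
Unset Printing Implicit Defensive.

Local Open Scope fset_scope.

(* Variables, which are also the selectors, are the elements of nat. *)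
Notation var := nat (only parsing).

(* Formulae over a signature P of predicate symbols with arities ar. Binders
   are named; alpha-equivalent formulae are distinct terms. *)
Inductive formula (P : Type) (ar : P -> nat) : Type :=
  | Atom (p : P) (xs : (ar p).-tuple var)
  | Tensor (A B : formula ar)
  | Lolli (A B : formula ar)
  | Ex (x : var) (A : formula ar)
  | All (x : var) (A : formula ar).

Arguments Atom {P ar} p xs.

Fixpoint fv (P : Type) (ar : P -> nat) (A : formula ar) : {fset var} :=
  match A with
  | Atom _ xs => [fset x | x in val xs]
  | Tensor A B | Lolli A B => fv A `|` fv B
  | Ex x A | All x A => fv A `\ x
  end.

Definition fvs (P : Type) (ar : P -> nat) (G : seq (formula ar)) : {fset var} :=
  \bigcup_(A <- G) fv A.

Definition upd (h : var -> var) (x y : var) : var -> var :=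
  fun z => if z == x then y else h z.

Definition fresh (S : {fset var}) : var := (\max_(x <- S) x).+1.

(* Capture-avoiding simultaneous substitution A[h]. Every binder is renamed,
   to a variable outside the h-image of the free variables of the quantified
   formula, so the result is A[h] up to alpha-equivalence. *)
Fixpoint subst (P : Type) (ar : P -> nat) (h : var -> var) (A : formula ar) :
    formula ar :=
  match A with
  | Atom p xs => Atom p [tuple of map h xs]
  | Tensor A B => Tensor (subst h A) (subst h B)
  | Lolli A B => Lolli (subst h A) (subst h B)
  | Ex x A => let z := fresh [fset h y | y in fv A `\ x] in
              Ex z (subst (upd h x z) A)
  | All x A => let z := fresh [fset h y | y in fv A `\ x] in
               All z (subst (upd h x z) A)
  end.

(* A[y/x] *)
Definition subst1 (P : Type) (ar : P -> nat) (y x : var) (A : formula ar) :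
    formula ar :=
  subst (upd id x y) A.

(* The multiset of antecedents is a list taken up to permutation. *)
Inductive mill1 (P : Type) (ar : P -> nat) :
    seq (formula ar) -> formula ar -> Prop :=
  | MExch G D C : Permutation G D -> mill1 G C -> mill1 D C
  | MAx A : mill1 [:: A] A
  | MTensorL G A B C : mill1 [:: A, B & G] C -> mill1 (Tensor A B :: G) C
  | MTensorR G D A B : mill1 G A -> mill1 D B -> mill1 (G ++ D) (Tensor A B)
  | MLolliL G D A B C :
      mill1 G A -> mill1 (B :: D) C -> mill1 (Lolli A B :: G ++ D) C
  | MLolliR G A B : mill1 (A :: G) B -> mill1 G (Lolli A B)
  | MExL G x z A C : z \notin fvs [:: Ex x A, C & G] ->
      mill1 (subst1 z x A :: G) C -> mill1 (Ex x A :: G) C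
  | MExR G x y A : mill1 G (subst1 y x A) -> mill1 G (Ex x A)
  | MAllL G x y A C : mill1 (subst1 y x A :: G) C -> mill1 (All x A :: G) C
  | MAllR G x z A : z \notin fvs (All x A :: G) ->
      mill1 G (subst1 z x A) -> mill1 G (All x A).

(* The rules are cut-free and hence analytic, so a sequent of such formulae is
   derivable in the fragment exactly when it is derivable in the full system. *)
Fixpoint lolli_forall (P : Type) (ar : P -> nat) (A : formula ar) : bool :=
  match A with
  | Atom _ _ => true
  | Lolli A B => lolli_forall A && lolli_forall B
  | All _ A => lolli_forall A
  | Tensor _ _ | Ex _ _ => false
  end.

Record hypergraph (T : Type) (ty : T -> {fset var}) := Hypergraph {
  hnode : finType;
  hedge : finType;
  hlab : hedge -> T;
  hatt : forall e : hedge, ty (hlab e) -> hnode;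
  htype : {fset var};
  hext : htype -> hnode
}.

(* The membership proofs are quantified separately so that att and ext are
   compared without casts along equalities of labels and types. *)
Definition hiso (T : Type) (ty : T -> {fset var}) (H K : hypergraph ty) : Prop :=
  exists (f : hnode H -> hnode K) (g : hedge H -> hedge K),
    [/\ bijective f, bijective g,
        forall e, hlab (g e) = hlab e,
        forall e s (i : s \in ty (hlab e)) (j : s \in ty (hlab (g e))),
          hatt (e := g e) [` j] = f (hatt (e := e) [` i])
      & htype H = htype K /\
        forall s (i : s \in htype H) (j : s \in htype K),
          hext [` j] = f (hext [` i])].

(* Quotient of V by the equivalence relation generated by r. *)
Definition eqclass (V : finType) (r : rel V) (v : V) : {set V} :=
  [set w | connect (fun a b => r a b || r b a) v w].

Definition quot (V : finType) (r : rel V) : finType :=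
  {B : {set V} | B \in [set eqclass r v | v in V]}%type.

Definition inquot (V : finType) (r : rel V) (v : V) : quot r :=
  exist _ (eqclass r v) (imset_f (eqclass r) (isT : v \in V)).

Definition hempty (T : Type) (ty : T -> {fset var}) : hypergraph ty :=
  @Hypergraph T ty void void (fun e => match e with end)
    (fun e => match e with end) fset0
    (fun s => False_rect _ (notF (etrans (esym (in_fset0 (val s))) (valP s)))).

Lemma par_in2 (S1 S2 : {fset var}) (s : S1 `|` S2) :
  val s \notin S1 -> val s \in S2.
Proof. by move=> /negPf s1; have := valP s; rewrite in_fsetU s1. Qed.

Section Par.
Context {T : Type} {ty : T -> {fset var}} (H1 H2 : hypergraph ty).

Definition par_rel : rel (hnode H1 + hnode H2) := fun a b =>
  match a, b with
  | inl v, inr w => [exists s1 : htype H1, exists s2 : htype H2,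
      [&& val s1 == val s2, hext s1 == v & hext s2 == w]]
  | _, _ => false
  end.

Definition par_lab (e : hedge H1 + hedge H2) : T :=
  match e with inl e => hlab e | inr e => hlab e end.

Definition par_att (e : hedge H1 + hedge H2) :
    ty (par_lab e) -> hnode H1 + hnode H2 :=
  match e with
  | inl e => fun s => inl (hatt s)
  | inr e => fun s => inr (hatt s)
  end.

Definition par_ext (s : htype H1 `|` htype H2) : hnode H1 + hnode H2 :=
  match boolP (val s \in htype H1) with
  | AltTrue i => inl (hext [` i])
  | AltFalse i => inr (hext [` par_in2 i])
  end.

Definition hpar : hypergraph ty :=
  @Hypergraph T ty (quot par_rel) (hedge H1 + hedge H2)%type par_lab
    (fun e s => inquot par_rel (par_att s))
    (htype H1 `|` htype H2)
    (fun s => inquot par_rel (par_ext s)).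

End Par.

Lemma sub_preim (h : var -> var) (S : {fset var}) (t : [fset h x | x in S]) :
  exists s : S, h (val s) == val t.
Proof. by case: t => t /= /imfsetP [x /= xS ->]; exists [` xS]. Qed.

Section Sub.
Context {T : Type} {ty : T -> {fset var}} (h : var -> var) (H : hypergraph ty).

Definition sub_rel : rel (hnode H) := fun v w =>
  [exists s1 : htype H, exists s2 : htype H,
    [&& h (val s1) == h (val s2), hext s1 == v & hext s2 == w]].

(* sub_h for total h. The node named t is the class of ext(s) for any s with
   h s = t; all such s yield the same class. *)
Definition hsub : hypergraph ty :=
  @Hypergraph T ty (quot sub_rel) (hedge H) (@hlab _ _ H)
    (fun e s => inquot sub_rel (hatt s))
    [fset h x | x in htype H]
    (fun t => inquot sub_rel (hext (xchoose (sub_preim t)))).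

End Sub.

(* Sets of abstract hypergraphs are represented by predicates on concrete
   hypergraphs that are invariant under isomorphism. *)
Definition hset (T : Type) (ty : T -> {fset var}) := hypergraph ty -> Prop.

Definition lpar (T : Type) (ty : T -> {fset var}) (L1 L2 : hset ty) : hset ty :=
  fun H => exists H1 H2, [/\ L1 H1, L2 H2 & hiso (hpar H1 H2) H].

Record hmodel (P : Type) (ar : P -> nat) := HModel {
  mlab : Type;
  mtype : mlab -> {fset var};
  mval : formula ar -> hset mtype;
  mval_iso : forall A H K, hiso H K -> mval A H -> mval A K;
  mval_sub : forall (h : var -> var) A H,
    mval A H -> mval (subst h A) (hsub h H);
  mval_tensor : forall A B H,
    mval (Tensor A B) H <-> lpar (mval A) (mval B) H;
  mval_lolli : forall A B H,
    mval (Lolli A B) H <-> forall K, mval A K -> mval B (hpar H K);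
  mval_ex : forall x A H, mval (Ex x A) H <-> exists y, mval (subst1 y x A) H;
  mval_all : forall x A H, mval (All x A) H <-> forall y, mval (subst1 y x A) H
}.

Arguments mval {P ar} M A H : rename.

Definition true_in (P : Type) (ar : P -> nat) (M : hmodel ar)
    (G : seq (formula ar)) (B : formula ar) : Prop :=
  match G with
  | [::] => mval M B (hempty (@mtype P ar M))
  | A :: G' => forall H,
      foldl (fun L C => lpar L (mval M C)) (mval M A) G' H ->
      mval M B H
  end.

(* Main.v *)
Require Import Defs.
From mathcomp Require Import all_boot finmap.
From Stdlib Require Import Permutation.
From mathcomp Require Import zify.

Set Implicit Arguments.
Unset Strict Implicit.
Unset Printing Implicit Defensive.

(** Soundness goes by induction on derivations, for all substitution instances
    of the sequent at once; the structural rules hold because parallel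
    composition is a commutative monoid up to isomorphism.

    For completeness, edges are labelled by formulae, and a hypergraph without
    internal nodes is read as a pair (Gm, E): the list of its labels, renamed
    along the attachments, and the equations between selectors sharing a node.
    An atom is interpreted by the pairs such that, for every renaming v
    satisfying E, the atom renamed by v is derivable from Gm renamed by v; the
    other connectives are forced by the definition of a model.  Okada's
    argument then shows that in the fragment (A, no equations) belongs to the
    value of A, and that a member of the value of B derives B without cut.
    Closure under substitutions, which for A -o B requires transporting an
    element of the value of A[h] back to one of A, is a monotonicity property
    of forcing in (Gm, E).  An additional label None without free variables,
    in the presence of which all atoms hold, makes all values nonempty, so that
    no hypergraph with an internal node belongs to any value. *)

Local Open Scope fset_scope.

(** * Substitution *)

Section Substitution.
Context {P : Type} {ar : P -> nat}.
Implicit Types (A B C : formula ar) (G D : seq (formula ar)) (h g : var -> var).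

Lemma fresh_gt (S : {fset var}) x : x \in S -> x < fresh S.
Proof.
by move=> xS; rewrite /fresh ltnS; apply: (@leq_bigmax_seq _ (enum_fset S) xpredT id).
Qed.

Lemma fresh_notin (S : {fset var}) : fresh S \notin S.
Proof. by apply/negP => /fresh_gt; rewrite ltnn. Qed.

Lemma fresh_neq (S : {fset var}) x : x \in S -> x != fresh S.
Proof. by move/fresh_gt; rewrite ltn_neqAle => /andP []. Qed.

Lemma subst_ext h g A : {in fv A, h =1 g} -> subst h A = subst g A.
Proof.
elim: A h g => [p xs|A IHA B IHB|A IHA B IHB|x A IHA|x A IHA] h g /= hg.
- congr Atom; apply: val_inj => /=; apply/eq_in_map => x xs_x.
  by apply: hg; rewrite inE.
- by rewrite (IHA h g) ?(IHB h g) // => x xA; apply: hg; rewrite in_fsetU xA ?orbT.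
- by rewrite (IHA h g) ?(IHB h g) // => x xA; apply: hg; rewrite in_fsetU xA ?orbT.
- have -> : [fset h y | y in fv A `\ x] = [fset g y | y in fv A `\ x].
    by apply: eq_in_imfset.
  congr Ex; apply: IHA => y yA; rewrite /upd; case: eqVneq => // yx.
  by apply: hg; rewrite in_fsetD1 yx.
- have -> : [fset h y | y in fv A `\ x] = [fset g y | y in fv A `\ x].
    by apply: eq_in_imfset.
  congr All; apply: IHA => y yA; rewrite /upd; case: eqVneq => // yx.
  by apply: hg; rewrite in_fsetD1 yx.
Qed.

Lemma imfset_upd h x z (S : {fset var}) :
  z \notin [fset h y | y in S `\ x] ->
  [fset upd h x z y | y in S] `\ z = [fset h y | y in S `\ x].
Proof.
move=> zS; apply/fsetP => t; rewrite in_fsetD1; apply/andP/imfsetP => /=.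
  case=> tz /imfsetP [y /= yS def_t]; exists y; last first.
    by move: tz; rewrite def_t /upd; case: (y == x) => //; rewrite eqxx.
  by rewrite in_fsetD1 yS andbT; apply: contraNneq tz => yx;
     rewrite def_t /upd yx eqxx.
case=> y /= yS def_t; split.
  by apply: contraNneq zS => <-; apply/imfsetP; exists y.
move: yS; rewrite in_fsetD1 => /andP [yx yS].
by apply/imfsetP; exists y => //; rewrite /upd (negPf yx).
Qed.

Lemma imfset_imfset h g (S : {fset var}) :
  [fset g t | t in [fset h y | y in S]] = [fset (g \o h) y | y in S].
Proof.
apply/fsetP => t; apply/imfsetP/imfsetP => /= [] [y].
  by case/imfsetP => /= s sS -> ->; exists s.
by move=> yS ->; exists (h y) => //; apply/imfsetP; exists y.
Qed.

Lemma fv_subst h A : fv (subst h A) = [fset h y | y in fv A].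
Proof.
elim: A h => [p xs|A IHA B IHB|A IHA B IHB|x A IHA|x A IHA] h /=.
- apply/fsetP => y; rewrite inE; apply/mapP/imfsetP => [] [x /= xs_x ->];
    by exists x => //; move: xs_x; rewrite inE.
- by rewrite IHA IHB imfsetU.
- by rewrite IHA IHB imfsetU.
- by rewrite IHA imfset_upd // fresh_notin.
- by rewrite IHA imfset_upd // fresh_notin.
Qed.

(** This is a literal equality, not one up to alpha-equivalence: the name given to a binder depends
    only on the image of the free variables, and that image is the same set on both sides. *)
Lemma subst_comp h g A : subst g (subst h A) = subst (g \o h) A.
Proof.
elim: A h g => [p xs|A IHA B IHB|A IHA B IHB|x A IHA|x A IHA] h g /=.
- by congr Atom; apply: val_inj => /=; rewrite -map_comp.
- by rewrite IHA IHB.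
- by rewrite IHA IHB.
- set z1 := fresh [fset h y | y in fv A `\ x]; rewrite fv_subst imfset_upd ?fresh_notin //
    imfset_imfset.
  set z := fresh _; congr Ex; rewrite IHA.
  apply: subst_ext => y yA; rewrite /upd /=; case: (eqVneq y x) => [|yx] /=; rewrite ?eqxx //.
  rewrite ifN //; apply: fresh_neq; apply/imfsetP; exists y => //=.
  by rewrite in_fsetD1 yx.
- set z1 := fresh [fset h y | y in fv A `\ x]; rewrite fv_subst imfset_upd ?fresh_notin //
    imfset_imfset.
  set z := fresh _; congr All; rewrite IHA.
  apply: subst_ext => y yA; rewrite /upd /=; case: (eqVneq y x) => [|yx] /=; rewrite ?eqxx //.
  rewrite ifN //; apply: fresh_neq; apply/imfsetP; exists y => //=.
  by rewrite in_fsetD1 yx.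
Qed.

(** No free variable other than [x] is sent to [z], so instantiating [z] afterwards only affects
    [x]. This undoes the renaming of a binder performed by [subst]. *)
Lemma subst1_bind h x y z A : z \notin [fset h y | y in fv A `\ x] ->
  subst1 y z (subst (upd h x z) A) = subst (upd h x y) A.
Proof.
move=> zA; rewrite /subst1 subst_comp; apply: subst_ext => t tA.
rewrite /upd /=; case: (eqVneq t x) => [|tx] /=; rewrite ?eqxx // ifN //.
by apply: contraNneq zA => <-; apply/imfsetP; exists t => //=; rewrite in_fsetD1 tx.
Qed.

Lemma subst_subst1 h x y A :
  subst h (subst1 y x A) = subst (upd h x (h y)) A.
Proof.
rewrite /subst1 subst_comp; apply: subst_ext => t _.
by rewrite /upd /=; case: ifP.
Qed.

(** Lets an eigenvariable [z] take the value [y] by changing the outer substitution at [z]. *)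
Lemma subst_subst1_fresh h x y z A : z \notin fv A `\ x ->
  subst (upd h z y) (subst1 z x A) = subst (upd h x y) A.
Proof.
move=> zA; rewrite subst_subst1; apply: subst_ext => t tA.
rewrite /upd eqxx; case: (eqVneq t x) => // tx; rewrite ifN //.
by apply: contraNneq zA => <-; rewrite in_fsetD1 tx.
Qed.

Lemma subst_upd_notin h y z A : z \notin fv A -> subst (upd h z y) A = subst h A.
Proof.
by move=> zA; apply: subst_ext => t tA; rewrite /upd ifN //; apply: contraNneq zA => <-.
Qed.

Lemma fvs_cons A G : fvs (A :: G) = fv A `|` fvs G.
Proof. by rewrite /fvs big_cons. Qed.

Lemma map_subst_upd_notin h y z G : z \notin fvs G ->
  map (subst (upd h z y)) G = map (subst h) G.
Proof.
elim: G => //= A G IHG; rewrite fvs_cons in_fsetU negb_or => /andP [zA zG].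
by rewrite subst_upd_notin // IHG.
Qed.

End Substitution.

(** * Quotients and isomorphisms of hypergraphs *)

Section Quotient.
Context {V : finType} (r : rel V).

Lemma inquot_surj (B : quot r) : exists v, inquot r v == B.
Proof.
by case: B => B hB; have /imsetP [v _ def_B] := hB; exists v; rewrite -val_eqE /= def_B.
Qed.

Definition qrep (B : quot r) : V := xchoose (inquot_surj B).

Lemma qrepK B : inquot r (qrep B) = B.
Proof. exact: (eqP (xchooseP (inquot_surj B))). Qed.

Let rs := fun a b => r a b || r b a.

Lemma connect_rs_sym : connect_sym rs.
Proof. by apply: sym_connect_sym => a b; rewrite /rs orbC. Qed.

Lemma inquot_rel a b : r a b -> inquot r a = inquot r b.
Proof.
move=> rab; apply: val_inj; apply/setP => c; rewrite !inE.
apply: same_connect; first exact: connect_rs_sym.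
by apply: connect1; rewrite /rs rab.
Qed.

Lemma inquot_invariant (W : Type) (f : V -> W) :
  (forall a b, r a b -> f a = f b) ->
  forall a b, inquot r a = inquot r b -> f a = f b.
Proof.
move=> fr a b /(congr1 (fun B : quot r => b \in val B)).
rewrite /= !inE connect0 => /connectP [p + ->] {b}.
elim: p a => //= b p IHp a /andP [+ /IHp <-].
by case/orP => /fr.
Qed.

(** The universal property of the quotient, which spares later arguments any choice of
    representatives. *)
Lemma quot_lift (W : Type) (f : V -> W) :
  (forall a b, r a b -> f a = f b) ->
  exists F : quot r -> W, forall a, F (inquot r a) = f a.
Proof.
move=> fr; exists (f \o qrep) => a /=.
by apply: (inquot_invariant fr); rewrite qrepK.
Qed.

End Quotient.

Section Hypergraphs.
Context {T : Type} {ty : T -> {fset var}}.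
Implicit Types (H K L : hypergraph ty) (s : var).

(* The graphs of ext and att: they avoid transporting membership proofs. *)
Definition ext_at H s w := exists i : s \in htype H, hext [` i] = w.

Definition att_at H e s w :=
  exists i : s \in ty (hlab e), @hatt _ _ H e [` i] = w.

Lemma ext_at_fun H s w w' : @ext_at H s w -> ext_at s w' -> w = w'.
Proof. by case=> i <- [j <-]; rewrite (bool_irrelevance i j). Qed.

Lemma att_at_fun H e s w w' : @att_at H e s w -> att_at e s w' -> w = w'.
Proof. by case=> i <- [j <-]; rewrite (bool_irrelevance i j). Qed.

Lemma hext_at H (s : htype H) : ext_at (val s) (hext s).
Proof. by case: s => s i; exists i. Qed.

Lemma ext_at_total H s : s \in htype H -> exists w, @ext_at H s w.
Proof. by move=> i; exists (hext [` i]); exists i. Qed.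

Lemma ext_at_type H s w : @ext_at H s w -> s \in htype H.
Proof. by case. Qed.

(** The condition on [f'] yields the inclusion of the type of [K] in that of [H]. Attachments need
    one direction only, since equal labels already have equal types. *)
Lemma hiso_intro H K (f : hnode H -> hnode K) (f' : hnode K -> hnode H)
    (g : hedge H -> hedge K) (g' : hedge K -> hedge H) :
  cancel f f' -> cancel f' f -> cancel g g' -> cancel g' g ->
  (forall e, hlab (g e) = hlab e) ->
  (forall e s w, @att_at H e s w -> @att_at K (g e) s (f w)) ->
  (forall s w, ext_at s w -> ext_at s (f w)) ->
  (forall s w, ext_at s w -> ext_at s (f' w)) ->
  hiso H K.
Proof.
move=> fK f'K gK g'K labg attg extf extf'; exists f, g; split => //.
- by exists f'.
- by exists g'.
- move=> e s i j; have /attg : att_at e s (hatt [` i]) by exists i.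
  by apply: att_at_fun; exists j.
split=> [|s i j].
  apply/fsetP => s; apply/idP/idP.
    by case/ext_at_total => w /extf /ext_at_type.
  by case/ext_at_total => w /extf' /ext_at_type.
have /extf : ext_at s (hext [` i]) by exists i.
by apply: ext_at_fun; exists j.
Qed.

Lemma hiso_elim H K : hiso H K ->
  exists (f : hnode H -> hnode K) (f' : hnode K -> hnode H)
    (g : hedge H -> hedge K) (g' : hedge K -> hedge H),
  [/\ cancel f f' /\ cancel f' f, cancel g g' /\ cancel g' g &
  [/\
  (forall e, hlab (g e) = hlab e),
  (forall e s w, @att_at H e s w -> @att_at K (g e) s (f w)),
  (forall s w, ext_at s w -> ext_at s (f w)) &
  (forall s w, ext_at s w -> ext_at s (f' w))]].
Proof.
case=> f [g [[f' fK f'K] [g' gK g'K] labg attg [tyHK extf]]].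
exists f, f', g, g'; split => //; split => //.
- move=> e s w [i <-]; have j : s \in ty (hlab (g e)) by rewrite labg.
  by exists j; apply: attg.
- move=> s w [i <-]; have j : s \in htype K by rewrite -tyHK.
  by exists j; apply: extf.
- move=> s w [j <-]; have i : s \in htype H by rewrite tyHK.
  by exists i; rewrite (extf s i j) fK.
Qed.

Lemma hiso_refl H : hiso H H.
Proof. exact: (@hiso_intro H H id id id id). Qed.

Lemma hiso_sym H K : hiso H K -> hiso K H.
Proof.
case/hiso_elim => f [f' [g [g' [[fK f'K] [gK g'K] [labg attg extf extf']]]]].
apply: (hiso_intro f'K fK g'K gK) => // [e|e s w att_w].
  by rewrite -labg g'K.
have [i _] := att_w; move: (i); rewrite -{1}[e]g'K labg => j.
have /attg : att_at (g' e) s (hatt [` j]) by exists j.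
by rewrite g'K => /(att_at_fun att_w) ->; rewrite fK; exists j.
Qed.

Lemma hiso_trans H K L : hiso H K -> hiso K L -> hiso H L.
Proof.
case/hiso_elim => f [f' [g [g' [[fK f'K] [gK g'K] [labg attg extf extf']]]]].
case/hiso_elim => k [k' [l [l' [[kK k'K] [lK l'K] [labl attl extk extk']]]]].
apply: (@hiso_intro H L (k \o f) (f' \o k') (l \o g) (g' \o l')).
- exact: can_comp.
- exact: can_comp.
- exact: can_comp.
- exact: can_comp.
- by move=> e; rewrite /= labl labg.
- by move=> e s w /attg /attl.
- by move=> s w /extf /extk.
- by move=> s w /extk' /extf'.
Qed.

(** * Parallel composition as a pushout *)

Section ParProperties.
Context (H1 H2 : hypergraph ty).

Definition inl_par (v : hnode H1) : hnode (hpar H1 H2) :=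
  inquot (@par_rel _ _ H1 H2) (inl v).
Definition inr_par (v : hnode H2) : hnode (hpar H1 H2) :=
  inquot (@par_rel _ _ H1 H2) (inr v).

Lemma par_nodeP (w : hnode (hpar H1 H2)) :
  (exists v, w = inl_par v) \/ (exists v, w = inr_par v).
Proof.
by rewrite -(qrepK w); case: (qrep w) => v; [left|right]; exists v.
Qed.

Lemma par_relP v w : reflect (exists s, ext_at s v /\ ext_at s w)
  (@par_rel _ _ H1 H2 (inl v) (inr w)).
Proof.
apply: (iffP idP) => [/existsP [s1 /existsP [s2 /and3P [/eqP s12 /eqP <- /eqP <-]]]|].
  by exists (val s1); split; [|rewrite s12]; exact: hext_at.
case=> s [[i <-] [j <-]]; apply/existsP; exists [` i]; apply/existsP; exists [` j].
by rewrite /= !eqxx.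
Qed.

Lemma par_fuse s v w : ext_at s v -> ext_at s w -> inl_par v = inr_par w.
Proof. by move=> sv sw; apply: inquot_rel; apply/par_relP; exists s. Qed.

(** The universal property of the pushout: every map out of a parallel composition below is obtained
    from it. *)
Lemma par_lift (W : Type) (f1 : hnode H1 -> W) (f2 : hnode H2 -> W) :
  (forall s v w, ext_at s v -> ext_at s w -> f1 v = f2 w) ->
  exists f : hnode (hpar H1 H2) -> W,
    (forall v, f (inl_par v) = f1 v) /\ (forall w, f (inr_par w) = f2 w).
Proof.
move=> f12; pose f0 a := match a with inl v => f1 v | inr w => f2 w end.
have [|f fE] := @quot_lift _ (@par_rel _ _ H1 H2) W f0.
  by case=> v [] w // /par_relP [s []]; apply: f12.
by exists f; split => v; [apply: (fE (inl v)) | apply: (fE (inr v))].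
Qed.

Lemma par_extP (s : htype H1 `|` htype H2) :
  (exists2 i : val s \in htype H1, True & par_ext s = inl (hext [` i])) \/
  (exists2 j : val s \notin htype H1, True & par_ext s = inr (hext [` par_in2 j])).
Proof.
rewrite /par_ext.
(* The branches of [par_ext] contain the membership proofs, so the case analysis abstracts the proof
   [p] in an explicit return clause. *)
refine (match boolP (val s \in htype H1) as p in alt_spec _ _ b
  return (exists2 i : val s \in htype H1, True &
            match p with AltTrue i => inl (hext [` i])
                       | AltFalse j => inr (hext [` par_in2 j]) end
            = inl (hext [` i])) \/
         (exists2 j : val s \notin htype H1, True &
            match p with AltTrue i => inl (hext [` i])
                       | AltFalse j => inr (hext [` par_in2 j]) end
            = inr (hext [` par_in2 j]))
  with AltTrue i => _ | AltFalse j => _ end); [left | right].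
- by exists i.
- by exists j.
Qed.

Lemma ext_at_inl s v : ext_at s v -> ext_at s (inl_par v).
Proof.
move=> sv; have i := ext_at_type sv.
have j : s \in htype (hpar H1 H2) by rewrite in_fsetU i.
exists j; rewrite /=; case: (par_extP [` j]) => [] [i' _ ->]; last first.
  by have := i'; rewrite /= => /negP [].
by congr (inl_par _); apply: ext_at_fun sv; exists i'.
Qed.

Lemma ext_at_inr s w : ext_at s w -> ext_at s (inr_par w).
Proof.
move=> sw; have i := ext_at_type sw.
have j : s \in htype (hpar H1 H2) by rewrite in_fsetU i orbT.
exists j; rewrite /=; case: (par_extP [` j]) => [] [i' _ ->].
  by apply: (par_fuse (s := s)) => //; exists i'.
by congr (inr_par _); apply: ext_at_fun sw; exists (par_in2 i').
Qed.

Lemma ext_at_par s w : @ext_at (hpar H1 H2) s w ->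
  (exists2 v, ext_at s v & w = inl_par v) \/ (exists2 v, ext_at s v & w = inr_par v).
Proof.
move=> sw; have := ext_at_type sw; rewrite in_fsetU => /orP [] /ext_at_total [v sv].
  by left; exists v => //; apply: ext_at_fun sw (ext_at_inl sv).
by right; exists v => //; apply: ext_at_fun sw (ext_at_inr sv).
Qed.

Lemma att_at_inl e s v : @att_at H1 e s v -> @att_at (hpar H1 H2) (inl e) s (inl_par v).
Proof. by case=> i <-; exists i. Qed.

Lemma att_at_inr e s v : @att_at H2 e s v -> @att_at (hpar H1 H2) (inr e) s (inr_par v).
Proof. by case=> i <-; exists i. Qed.

Lemma att_at_parl e s w : @att_at (hpar H1 H2) (inl e) s w ->
  exists2 v, att_at e s v & w = inl_par v.
Proof. by case=> i <-; exists (hatt (e := e) [` i]) => //; exists i. Qed.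

Lemma att_at_parr e s w : @att_at (hpar H1 H2) (inr e) s w ->
  exists2 v, att_at e s v & w = inr_par v.
Proof. by case=> i <-; exists (hatt (e := e) [` i]) => //; exists i. Qed.

End ParProperties.

Lemma hparC H K : hiso (hpar H K) (hpar K H).
Proof.
have [s v w sv sw|f [fl fr]] := @par_lift H K _ (@inr_par K H) (@inl_par K H).
  by rewrite (par_fuse sw sv).
have [s v w sv sw|f' [fl' fr']] := @par_lift K H _ (@inr_par H K) (@inl_par H K).
  by rewrite (par_fuse sw sv).
pose g A B (e : A + B) : B + A := match e with inl e => inr e | inr e => inl e end.
apply: (@hiso_intro (hpar H K) (hpar K H) f f' (@g _ _) (@g _ _)).
- by move=> w; case: (par_nodeP w) => [] [v ->]; rewrite ?fl ?fr ?fl' ?fr'.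
- by move=> w; case: (par_nodeP w) => [] [v ->]; rewrite ?fl' ?fr' ?fl ?fr.
- by case.
- by case.
- by case.
- case=> e s w.
    by case/att_at_parl => v ? ->; rewrite fl; apply: att_at_inr.
  by case/att_at_parr => v ? ->; rewrite fr; apply: att_at_inl.
- move=> s w /ext_at_par [] [v ? ->]; rewrite ?fl ?fr.
    exact: ext_at_inr.
  exact: ext_at_inl.
- move=> s w /ext_at_par [] [v ? ->]; rewrite ?fl' ?fr'.
    exact: ext_at_inr.
  exact: ext_at_inl.
Qed.

Lemma hparA H K L : hiso (hpar (hpar H K) L) (hpar H (hpar K L)).
Proof.
pose HKL := hpar H (hpar K L); pose HKL' := hpar (hpar H K) L.
pose i1 v : hnode HKL := inl_par _ v.
pose i2 v : hnode HKL := inr_par _ (inl_par _ v).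
pose i3 v : hnode HKL := inr_par _ (inr_par _ v).
pose j1 v : hnode HKL' := inl_par _ (inl_par _ v).
pose j2 v : hnode HKL' := inl_par _ (inr_par _ v).
pose j3 v : hnode HKL' := inr_par _ v.
(* Each of the two inverse maps is glued in two stages, first on the inner composition and then on
   the outer one. *)
have [s v w sv sw|f12 [f1 f2]] := @par_lift H K _ i1 i2.
  by apply: (par_fuse sv); apply: ext_at_inl.
have [s v w + sw|f [fl f3]] := @par_lift (hpar H K) L _ f12 i3.
  case/ext_at_par => [] [u su ->]; rewrite ?f1 ?f2.
    by apply: (par_fuse su); apply: ext_at_inr.
  by congr (inr_par _ _); apply: (par_fuse su).
have [s v w sv sw|g23 [g2 g3]] := @par_lift K L _ j2 j3.
  by apply: (par_fuse (s := s)) => //; apply: ext_at_inr.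
have [s v w sv|g [g1 gr]] := @par_lift H (hpar K L) _ j1 g23.
  case/ext_at_par => [] [u su ->]; rewrite ?g2 ?g3.
    by congr (inl_par _ _); apply: (par_fuse sv).
  by apply: (par_fuse (s := s)) => //; apply: ext_at_inl.
pose a (e : hedge HKL') : hedge HKL :=
  match e with
  | inl (inl e) => inl e | inl (inr e) => inr (inl e) | inr e => inr (inr e)
  end.
pose b (e : hedge HKL) : hedge HKL' :=
  match e with
  | inl e => inl (inl e) | inr (inl e) => inl (inr e) | inr (inr e) => inr e
  end.
have fE : ((forall v, f (j1 v) = i1 v) * (forall v, f (j2 v) = i2 v)
         * (forall v, f (j3 v) = i3 v))%type.
  by split=> [|v]; [split=> v|]; rewrite ?fl ?f1 ?f2 ?f3.
have gE : ((forall v, g (i1 v) = j1 v) * (forall v, g (i2 v) = j2 v)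
         * (forall v, g (i3 v) = j3 v))%type.
  by split=> [|v]; [split=> v|]; rewrite ?gr ?g1 ?g2 ?g3.
apply: (@hiso_intro HKL' HKL f g a b).
- move=> w; case: (par_nodeP w) => [] [v ->]; last by rewrite fE gE.
  by case: (par_nodeP v) => [] [u ->]; rewrite fE gE.
- move=> w; case: (par_nodeP w) => [] [v ->]; first by rewrite gE fE.
  by case: (par_nodeP v) => [] [u ->]; rewrite gE fE.
- by case=> [[]|].
- by case=> [|[]].
- by case=> [[]|].
- case=> [[]|] e s w.
  + case/att_at_parl => v /att_at_parl [u su ->] ->; rewrite fE.
    exact: att_at_inl.
  + case/att_at_parl => v /att_at_parr [u su ->] ->; rewrite fE.
    by apply: att_at_inr; apply: att_at_inl.
  + case/att_at_parr => v sv ->; rewrite fE.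
    by apply: att_at_inr; apply: att_at_inr.
- move=> s w /ext_at_par [] [v + ->].
    case/ext_at_par => [] [u su ->]; rewrite fE; first exact: ext_at_inl.
    by apply: ext_at_inr; apply: ext_at_inl.
  by move=> sv; rewrite fE; apply: ext_at_inr; apply: ext_at_inr.
- move=> s w /ext_at_par [] [v + ->].
    by move=> sv; rewrite gE; apply: ext_at_inl; apply: ext_at_inl.
  case/ext_at_par => [] [u su ->]; rewrite gE; last exact: ext_at_inr.
  by apply: ext_at_inl; apply: ext_at_inr.
Qed.

Lemma hparK0 H : hiso (hpar H (hempty ty)) H.
Proof.
have [s v []|f [fl fr]] := @par_lift H (hempty ty) _ id (fun v => match v with end).
pose g (e : hedge H + void) : hedge H :=
  match e with inl e => e | inr e => match e with end end.
apply: (@hiso_intro (hpar H (hempty ty)) H f (@inl_par _ _) g inl) => //.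
- by move=> w; case: (par_nodeP w) => [[v ->]|[[]]]; rewrite fl.
- by case=> [|[]].
- by case=> [|[]].
- by case=> [e|[]] s w /att_at_parl [v sv ->]; rewrite fl.
- by move=> s w /ext_at_par [[v sv ->]|[[]]]; rewrite fl.
- by move=> s w; apply: ext_at_inl.
Qed.

Lemma hpar_iso H H' K K' : hiso H H' -> hiso K K' -> hiso (hpar H K) (hpar H' K').
Proof.
case/hiso_elim => f [f' [g [g' [[fK f'K] [gK g'K] [labg attg extf extf']]]]].
case/hiso_elim => k [k' [l [l' [[kK k'K] [lK l'K] [labl attl extk extk']]]]].
have [s v w sv sw|F [Fl Fr]] :=
  @par_lift H K _ (@inl_par H' K' \o f) (@inr_par H' K' \o k).
  by apply: (par_fuse (s := s)); [apply: extf | apply: extk].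
have [s v w sv sw|F' [Fl' Fr']] :=
  @par_lift H' K' _ (@inl_par H K \o f') (@inr_par H K \o k').
  by apply: (par_fuse (s := s)); [apply: extf' | apply: extk'].
pose G (e : hedge (hpar H K)) : hedge (hpar H' K') :=
  match e with inl e => inl (g e) | inr e => inr (l e) end.
pose G' (e : hedge (hpar H' K')) : hedge (hpar H K) :=
  match e with inl e => inl (g' e) | inr e => inr (l' e) end.
apply: (@hiso_intro _ _ F F' G G').
- by move=> w; case: (par_nodeP w) => [] [v ->]; rewrite ?Fl ?Fr /= ?Fl' ?Fr' /= ?fK ?kK.
- by move=> w; case: (par_nodeP w) => [] [v ->]; rewrite ?Fl' ?Fr' /= ?Fl ?Fr /= ?f'K ?k'K.
- by case=> e /=; rewrite ?gK ?lK.
- by case=> e /=; rewrite ?g'K ?l'K.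
- by case=> e /=; rewrite ?labg ?labl.
- case=> e s w.
    by case/att_at_parl => v sv ->; rewrite Fl; apply: att_at_inl; apply: attg.
  by case/att_at_parr => v sv ->; rewrite Fr; apply: att_at_inr; apply: attl.
- move=> s w /ext_at_par [] [v sv ->]; rewrite ?Fl ?Fr.
    by apply: ext_at_inl; apply: extf.
  by apply: ext_at_inr; apply: extk.
- move=> s w /ext_at_par [] [v sv ->]; rewrite ?Fl' ?Fr'.
    by apply: ext_at_inl; apply: extf'.
  by apply: ext_at_inr; apply: extk'.
Qed.

End Hypergraphs.

(** * Soundness *)

Section Languages.
Context {T : Type} {ty : T -> {fset var}}.
Implicit Types (H K : hypergraph ty) (L : hset ty).

Definition iso_closed L := forall H K, hiso H K -> L H -> L K.

Lemma lpar_iso L1 L2 : iso_closed (lpar L1 L2).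
Proof.
by move=> H K isoHK [H1 [H2 [L1H L2H isoH]]]; exists H1, H2; split=> //;
   apply: hiso_trans isoHK.
Qed.

Lemma lparC L1 L2 H : lpar L1 L2 H -> lpar L2 L1 H.
Proof.
case=> H1 [H2 [L1H L2H isoH]]; exists H2, H1; split=> //.
exact: hiso_trans (hparC _ _) isoH.
Qed.

Lemma lparS L1 L1' L2 L2' H :
  (forall K, L1 K -> L1' K) -> (forall K, L2 K -> L2' K) ->
  lpar L1 L2 H -> lpar L1' L2' H.
Proof.
by move=> sub1 sub2 [H1 [H2 [L1H L2H isoH]]]; exists H1, H2; split; auto.
Qed.

Lemma lparA L1 L2 L3 H : lpar (lpar L1 L2) L3 H <-> lpar L1 (lpar L2 L3) H.
Proof.
split.
  case=> H12 [H3 [[H1 [H2 [L1H L2H isoH12]]] L3H isoH]].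
  exists H1, (hpar H2 H3); split=> //.
    by exists H2, H3; split=> //; apply: hiso_refl.
  apply: hiso_trans (hiso_sym (hparA _ _ _)) _.
  by apply: hiso_trans isoH; apply: hpar_iso => //; apply: hiso_refl.
case=> H1 [H23 [L1H [H2 [H3 [L2H L3H isoH23]]] isoH]].
exists (hpar H1 H2), H3; split=> //.
  by exists H1, H2; split=> //; apply: hiso_refl.
apply: hiso_trans (hparA _ _ _) _.
by apply: hiso_trans isoH; apply: hpar_iso => //; apply: hiso_refl.
Qed.

Lemma lpar0 L H : iso_closed L -> lpar L (hiso (hempty ty)) H <-> L H.
Proof.
move=> isoL; split.
  case=> H1 [H2 [LH1 isoH2 isoH]]; apply: (isoL _ _ isoH).
  apply: isoL (LH1); apply: hiso_trans (hiso_sym (hparK0 H1)) _.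
  by apply: hpar_iso => //; apply: hiso_refl.
by move=> LH; exists H, (hempty ty); split=> //; [apply: hiso_refl | apply: hparK0].
Qed.

(** Turns the left fold of [true_in], which starts at the first antecedent, into a right fold ending
    in the unit, so that empty and nonempty contexts are treated alike. *)
Lemma lpar_foldl (I : Type) (F : I -> hset ty) (s : seq I) L H : iso_closed L ->
  foldl (fun L i => lpar L (F i)) L s H <->
  lpar L (foldr (fun i => lpar (F i)) (hiso (hempty ty)) s) H.
Proof.
elim: s L H => [|i s IHs] L H isoL /=; first by rewrite lpar0.
by rewrite IHs; [exact: lparA | exact: lpar_iso].
Qed.

End Languages.

Section Soundness.
Context {P : Type} {ar : P -> nat} (M : hmodel ar).
Implicit Types (A B C : formula ar) (G D : seq (formula ar)).

Definition ctxval G : hset (@mtype _ _ M) :=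
  foldr (fun A => lpar (mval M A)) (hiso (hempty _)) G.

Lemma mval_iso_closed A : iso_closed (mval M A).
Proof. by move=> H K; apply: mval_iso. Qed.

Lemma ctxval_iso_closed G : iso_closed (ctxval G).
Proof.
case: G => [|A G] H K; last exact: lpar_iso.
by move=> isoHK /= iso0; apply: hiso_trans isoHK.
Qed.

Lemma true_inE G B :
  true_in M G B <-> forall H, ctxval G H -> mval M B H.
Proof.
case: G => [|A G] /=; split=> trueB.
- by move=> H isoH; apply: mval_iso isoH _.
- by apply: trueB; apply: hiso_refl.
- by move=> H /(lpar_foldl (mval M) G H (@mval_iso_closed A)); apply: trueB.
- by move=> H /(lpar_foldl (mval M) G H (@mval_iso_closed A)); apply: trueB.
Qed.

Lemma ctxval_cat G D H : ctxval (G ++ D) H <-> lpar (ctxval G) (ctxval D) H.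
Proof.
elim: G H => [|A G IHG] H /=.
  split; last by move/lparC/(lpar0 H (@ctxval_iso_closed D)).
  by move/(lpar0 H (@ctxval_iso_closed D))/lparC.
rewrite lparA; split; apply: lparS => // K; first by rewrite -IHG.
by rewrite -IHG.
Qed.

Lemma ctxval1 A H : ctxval [:: A] H <-> mval M A H.
Proof. exact: lpar0 (@mval_iso_closed A). Qed.

Lemma ctxval_perm G D H : Permutation G D -> ctxval G H -> ctxval D H.
Proof.
move=> permGD; elim: permGD H => //= [A G' D' _ IH H|A B G' H|G1 G2 G3 _ IH1 _ IH2 H].
- exact: lparS.
- rewrite -!lparA; apply: lparS => // K; exact: lparC.
- by move/IH1/IH2.
Qed.

Lemma mval_exE h x A H : mval M (subst h (Ex x A)) H <->
  exists y, mval M (subst (upd h x y) A) H.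
Proof.
by rewrite mval_ex; split=> [] [y AH]; exists y; move: AH;
   rewrite subst1_bind // fresh_notin.
Qed.

Lemma mval_allE h x A H : mval M (subst h (All x A)) H <->
  forall y, mval M (subst (upd h x y) A) H.
Proof.
by rewrite mval_all; split=> AH y; have := AH y;
   rewrite subst1_bind // fresh_notin.
Qed.

(* Closing under all substitutions h lets the eigenvariable of a quantifier
   rule be instantiated by changing h, without renaming selectors of H. *)
Lemma soundness_subst G B : mill1 G B ->
  forall h H, ctxval (map (subst h) G) H -> mval M (subst h B) H.
Proof.
elim=> {G B}.
- move=> G D C permGD _ IH h H DH; apply: IH.
  by apply: ctxval_perm DH; apply: Permutation_map; apply: Permutation_sym.
- by move=> A h H /ctxval1.
- move=> G A B C _ IH h H GH; apply: IH => /=.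
  by rewrite -lparA; apply: lparS GH => // K /mval_tensor.
- move=> G D A B _ IHA _ IHB h H; rewrite map_cat => /ctxval_cat GDH.
  by apply/mval_tensor; apply: lparS GDH => K; [apply: IHA | apply: IHB].
- move=> G D A B C _ IHA _ IHC h H /=; rewrite map_cat => GH; apply: IHC => /=.
  have {GH} : lpar (mval M (subst h (Lolli A B)))
      (lpar (ctxval (map (subst h) G)) (ctxval (map (subst h) D))) H.
    by apply: lparS GH => // K /ctxval_cat.
  rewrite -lparA; apply: lparS => // K [K1 [K2 [/mval_lolli LK1 /IHA AK2]]].
  by move=> isoK; apply: mval_iso isoK _; apply: LK1.
- move=> G A B _ IH h H GH; apply/mval_lolli => K AK; apply: IH => /=.
  by apply: lparC; exists H, K; split=> //; apply: hiso_refl.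
- move=> G x z A C; rewrite !fvs_cons !in_fsetU !negb_or => /and3P [zA zC zG].
  move=> _ IH h H [H1 [H2 [/mval_exE [y AH1] GH2 isoH]]].
  (* The induction hypothesis is used at [upd h z y]: as [z] is fresh, this leaves [C] and [G]
     unchanged and turns the premise instance into the one witnessed by [y]. *)
  rewrite -(subst_upd_notin h y zC); apply: IH => /=.
  by exists H1, H2; split=> //; rewrite ?subst_subst1_fresh ?map_subst_upd_notin.
- move=> G x y A _ IH h H GH; apply/mval_exE; exists (h y).
  by rewrite -subst_subst1; apply: IH.
- move=> G x y A C _ IH h H GH; apply: IH => /=.
  by apply: lparS GH => // K /mval_allE; rewrite subst_subst1.
- move=> G x z A; rewrite fvs_cons in_fsetU negb_or => /andP [zA zG].
  move=> _ IH h H GH; apply/mval_allE => y; rewrite -(subst_subst1_fresh h y zA).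
  by apply: IH; rewrite map_subst_upd_notin.
Qed.

(** [subst id] renames binders and is not the identity, but the value of a quantified formula
    depends only on its instances, which are the same for both formulae. *)
Lemma mval_subst_id A H : mval M (subst id A) H <-> mval M A H.
Proof.
elim: A H => [p xs|A IHA B IHB|A IHA B IHB|x A _|x A _] H.
- suff -> : subst id (Atom p xs) = Atom p xs by [].
  by congr Atom; apply: val_inj; rewrite /= map_id.
- by rewrite !mval_tensor; split; apply: lparS => K; rewrite ?IHA ?IHB.
- rewrite !mval_lolli; split=> AB K /IHA AK; apply/IHB; apply: AB AK.
- by rewrite mval_exE mval_ex.
- by rewrite mval_allE mval_all.
Qed.

Lemma soundness G B : mill1 G B -> true_in M G B.
Proof.
move=> GB; apply/true_inE => H GH; apply/mval_subst_id; apply: soundness_subst GB _ _ _.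
elim: G H GH => //= A G IHG H; apply: lparS => K; last exact: IHG.
by move/mval_subst_id.
Qed.

End Soundness.

(** * Structures and forcing *)

Section Matched.
Context {S T : Type}.

Definition matched (R : S -> T -> Prop) (s : seq S) (t : seq T) :=
  exists2 t', Permutation t t' & List.Forall2 R s t'.

Lemma matched_cat R s1 s2 t1 t2 :
  matched R s1 t1 -> matched R s2 t2 -> matched R (s1 ++ s2) (t1 ++ t2).
Proof.
case=> t1' perm1 R1 [t2' perm2 R2]; exists (t1' ++ t2').
  exact: Permutation_app.
exact: List.Forall2_app.
Qed.

Lemma matched_permr R s t t' : Permutation t t' -> matched R s t -> matched R s t'.
Proof.
move=> permt [u permu Ru]; exists u => //.
exact: Permutation_trans (Permutation_sym permt) permu.
Qed.

Lemma matched_perml R s s' t : Permutation s s' -> matched R s t -> matched R s' t.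
Proof.
move=> perms [u permu Ru]; have [u' [permu' Ru']] := Permutation_Forall2 perms Ru.
by exists u' => //; apply: Permutation_trans permu'.
Qed.

Lemma matched_split R s1 s2 t : matched R (s1 ++ s2) t ->
  exists t1 t2, [/\ Permutation t (t1 ++ t2), matched R s1 t1 & matched R s2 t2].
Proof.
case=> t' permt /List.Forall2_app_inv_l [t1 [t2 [R1 [R2 def_t']]]].
exists t1, t2; split; first by have <- : t' = t1 ++ t2 by [].
  by exists t1.
by exists t2.
Qed.

Lemma matched_impl (Q : S -> Prop) (R R' : S -> T -> Prop) s t :
  List.Forall Q s -> (forall a b, Q a -> R a b -> R' a b) ->
  matched R s t -> matched R' s t.
Proof.
move=> Qs RR' [t' permt Rst]; exists t' => //.
elim: Rst Qs => {s t t' permt} [|a b s t Rab _ IH] Qs; constructor.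
  by inversion Qs; apply: RR'.
by apply: IH; inversion Qs.
Qed.

Lemma matched_sub (R R' : S -> T -> Prop) s t :
  (forall a b, R a b -> R' a b) -> matched R s t -> matched R' s t.
Proof.
move=> RR'; apply: (@matched_impl (fun _ => True)) => [|a b _]; last exact: RR'.
by elim: s => //; constructor.
Qed.

Lemma matched_map (X : Type) (f : S -> X) (g : T -> X) s t :
  matched (fun a b => f a = g b) s t -> Permutation (map f s) (map g t).
Proof.
case=> t' permt Rst; apply: Permutation_sym.
suff -> : map f s = map g t' by apply: Permutation_map.
by elim: Rst => //= a b {}s {}t' {permt} -> _ ->.
Qed.

Lemma matched_mapl (R : S -> T -> Prop) (f : T -> S) t :
  (forall b, R (f b) b) -> matched R (map f t) t.
Proof. by move=> Rf; exists t => //; elim: t => //= b t IHt; constructor. Qed.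

Lemma matched_mapr (R : S -> T -> Prop) (f : S -> T) s :
  (forall a, R a (f a)) -> matched R s (map f s).
Proof. by move=> Rf; exists (map f s) => //; elim: s => //= b s IHs; constructor. Qed.

End Matched.

Lemma matched_refl (S : Type) (R : S -> S -> Prop) s :
  (forall a, R a a) -> matched R s s.
Proof. by move=> Rs; exists s => //; elim: s => //; constructor. Qed.

Lemma matched_comp (S T U : Type) (R : S -> T -> Prop) (R' : T -> U -> Prop) s t u :
  matched R s t -> matched R' t u ->
  matched (fun a c => exists2 b, R a b & R' b c) s u.
Proof.
case=> t' permt Rst [u' permu Rtu].
have [w [permw Rtw]] := Permutation_Forall2 permt Rtu.
exists w; first exact: Permutation_trans permu permw.
elim: Rst w Rtw {permt permw} => {s t'} [|a b s t' Rab _ IH] w Rt'w;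
  inversion Rt'w; constructor; [by exists b | exact: IH].
Qed.

Lemma matched_flip (S T : Type) (R : S -> T -> Prop) s t :
  matched R s t -> matched (fun b a => R a b) t s.
Proof.
case=> t' permt /List.Forall2_flip Rts.
apply: matched_perml (Permutation_sym permt) _.
by exists s.
Qed.

(** * Derivability from labels, and forcing by labels and equations *)

Section Sequents.
Context {P : Type} {ar : P -> nat}.
Implicit Types (A B C : formula ar) (Gm Dl : seq (option (formula ar))).
Implicit Types (E F : seq (var * var)) (v g h : var -> var).

(* None makes a sequent derivable by fiat; it keeps every interpretation
   nonempty. *)
Definition derives Gm C := ~~ all isSome Gm \/ mill1 (pmap id Gm) C.

Lemma derives_perm Gm Dl C : Permutation Gm Dl -> derives Gm C -> derives Dl C.
Proof.
move=> permGD; have -> : derives Gm C = (~~ all isSome Dl \/ mill1 (pmap id Gm) C).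
  rewrite /derives; congr (~~ _ \/ _).
  elim: permGD => //= [a G D _ ->|a b G|G1 G2 G3 _ -> _ ->] //.
  by rewrite !andbA [isSome b && _]andbC.
case=> [|GC]; [by left | right]; apply: MExch GC.
elim: permGD => //= [[a|] G D _ IH|[a|] [b|] G|G1 G2 G3 _ IH1 _ IH2] /=.
- exact: perm_skip.
- exact: IH.
- exact: perm_swap.
- exact: Permutation_refl.
- exact: Permutation_refl.
- exact: Permutation_refl.
- exact: Permutation_trans IH2.
Qed.

Lemma pmap_id_cat Gm Dl : pmap id (Gm ++ Dl) = pmap id Gm ++ pmap id Dl.
Proof. by elim: Gm => //= [[a|]] Gm /= ->. Qed.

Lemma derives_LolliL Gm Dl A B C : derives Gm A -> derives (Some B :: Dl) C ->
  derives (Some (Lolli A B) :: Gm ++ Dl) C.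
Proof.
rewrite /derives /= all_cat pmap_id_cat negb_and.
case=> [->|GA]; first by left.
case=> [->|DC]; first by left; rewrite orbT.
by right; apply: MLolliL.
Qed.

Lemma derives_LolliR Gm A B : derives (Some A :: Gm) B -> derives Gm (Lolli A B).
Proof. by case=> [|GB]; [left | right; apply: MLolliR]. Qed.

Lemma derives_AllL Gm x y A C : derives (Some (subst1 y x A) :: Gm) C ->
  derives (Some (All x A) :: Gm) C.
Proof. by case=> [|GB]; [left | right; apply: (MAllL (y := y))]. Qed.

Lemma derives_AllR Gm x z A : z \notin fvs (All x A :: pmap id Gm) ->
  derives Gm (subst1 z x A) -> derives Gm (All x A).
Proof. by move=> z_fresh [|GA]; [left | right; apply: MAllR z_fresh GA]. Qed.

Definition osubst h (c : option (formula ar)) := omap (subst h) c.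

Lemma osubst_comp h g c : osubst g (osubst h c) = osubst (g \o h) c.
Proof. by case: c => //= A; rewrite subst_comp. Qed.

(** The typing of the alphabet of the canonical model: an edge labelled by a formula has its free
    variables as selectors, and an edge labelled [None] is attached to nothing. *)
Definition label_fv (c : option (formula ar)) : {fset var} := oapp (@fv _ ar) fset0 c.

Definition below (n : nat) (c : option (formula ar)) :=
  forall x, x \in label_fv c -> x < n.

Lemma osubst_ext n h g c : below n c -> (forall x, x < n -> h x = g x) ->
  osubst h c = osubst g c.
Proof.
by case: c => //= A nA hg; congr Some; apply: subst_ext => x /nA; apply: hg.
Qed.

Lemma map_osubst_ext n h g Gm : List.Forall (below n) Gm ->
  (forall x, x < n -> h x = g x) -> map (osubst h) Gm = map (osubst g) Gm.
Proof.
by move=> nG hg; elim: nG => //= c {}Gm nc _ ->; rewrite (osubst_ext nc hg).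
Qed.

Lemma below_exists Gm : exists n, forall m, n <= m -> List.Forall (below m) Gm.
Proof.
elim: Gm => [|c Gm [n IHn]]; first by exists 0 => m _; constructor.
exists (maxn n (fresh (label_fv c))) => m.
rewrite geq_max => /andP [nm cm]; constructor; last exact: IHn.
by move=> x /fresh_gt xc; apply: leq_trans cm.
Qed.

Lemma fset_bound (S : {fset var}) g : exists n, forall m, n <= m ->
  forall x, x \in S -> g x < m.
Proof.
exists (fresh [fset g x | x in S]) => m le_m x xS; apply: leq_trans le_m.
by apply: fresh_gt; apply/imfsetP; exists x.
Qed.

Definition satisfies v E := forall p, p \in E -> v p.1 = v p.2.

Lemma satisfies_cat v E F : satisfies v (E ++ F) <-> satisfies v E /\ satisfies v F.
Proof.
split=> [vEF|[vE vF] p]; last by rewrite mem_cat => /orP []; auto.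
by split=> p pE; apply: vEF; rewrite mem_cat pE ?orbT.
Qed.

Lemma satisfies_bound E : exists n, forall m, n <= m -> forall p, p \in E ->
  p.1 < m /\ p.2 < m.
Proof.
exists (\max_(p <- E) maxn p.1 p.2).+1 => m lt_m p pE.
have := @leq_bigmax_seq _ E xpredT (fun p => maxn p.1 p.2) p pE isT.
by rewrite geq_max => /andP [p1 p2]; split; apply: leq_ltn_trans lt_m.
Qed.

Lemma satisfies_ext n v g E : (forall p, p \in E -> p.1 < n /\ p.2 < n) ->
  (forall x, x < n -> v x = g x) -> satisfies v E -> satisfies g E.
Proof.
by move=> nE vg vE p pE; have [p1 p2] := nE p pE; rewrite -!vg //; apply: vE.
Qed.

(** Supplies names beyond all those in use. The bound is a successor so that it can also be the size
    of an ordinal type of nodes in [describes_realize]. *)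
Lemma names_bound Gm E (S : {fset var}) g : exists n,
  [/\ List.Forall (below n.+1) Gm, forall p, p \in E -> p.1 < n.+1 /\ p.2 < n.+1 &
      forall x, x \in S -> g x < n.+1].
Proof.
have [n1 nG] := below_exists Gm; have [n2 nE] := satisfies_bound E.
have [n3 ng] := fset_bound S g.
by exists (maxn n1 (maxn n2 n3)); split; [apply: nG | apply: nE | apply: ng]; lia.
Qed.

(* A pair (Gm, E) stands for a hypergraph all of whose nodes are external: Gm
   lists the labels of its edges, renamed along their attachments, and E the
   pairs of selectors that share a node. *)
Fixpoint forces A g Gm E : Prop :=
  match A with
  | Atom p xs => forall v, satisfies v E ->
      derives (map (osubst v) Gm) (subst (v \o g) (Atom p xs))
  | Tensor A B => exists Gm1 E1 Gm2 E2,
      [/\ Permutation Gm (Gm1 ++ Gm2),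
          forall v, satisfies v E <-> satisfies v E1 /\ satisfies v E2,
          forces A g Gm1 E1 & forces B g Gm2 E2]
  | Lolli A B => forall Dl F, forces A g Dl F -> forces B g (Gm ++ Dl) (E ++ F)
  | Ex x A => exists y, forces A (upd g x y) Gm E
  | All x A => forall y, forces A (upd g x y) Gm E
  end.

(** Names equated by [E] are interchangeable, so labels are compared under every [v] satisfying [E]
    and not literally. *)
Definition agree h E (c d : option (formula ar)) :=
  forall v, satisfies v E -> osubst (v \o h) c = osubst v d.

(** Renaming along [h], adding equations and permuting labels are handled together, because the case
    of [Lolli] uses the hypothesis for its antecedent with a renaming other than [h]. *)
Lemma forces_mono A g g' h Gm Gm' E E' :
  (forall v, satisfies v E' -> satisfies (v \o h) E) ->
  matched (agree h E') Gm Gm' ->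
  (forall v, satisfies v E' -> forall x, x \in fv A -> v (h (g x)) = v (g' x)) ->
  forces A g Gm E -> forces A g' Gm' E'.
Proof.
elim: A g g' h Gm Gm' E E' => [p xs|A IHA B IHB|A IHA B IHB|x A IHA|x A IHA]
  g g' h Gm Gm' E E' hE hG hg.
- move=> GA v vE'; have := GA _ (hE v vE').
  rewrite (@subst_ext _ _ _ (v \o g')) => [|x xA]; last exact: hg.
  apply: derives_perm; apply: matched_map; apply: matched_sub hG => c d.
  exact.
- case=> Gm1 [E1 [Gm2 [E2 [permG E12 GA GB]]]].
  have [Gm1' [Gm2' [permG' hG1 hG2]]] := matched_split (matched_perml permG hG).
  (* Both factors may take all of [E'], which along [h] entails the equations of each. *)
  exists Gm1', E', Gm2', E'; split=> //.
  + by move=> v; split=> [|[]].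
  + apply: (IHA g g' h) GA => // v vE'; first by have /E12 [] := hE v vE'.
    by move=> x xA; apply: hg => //=; rewrite in_fsetU xA.
  + apply: (IHB g g' h) GB => // v vE'; first by have /E12 [] := hE v vE'.
    by move=> x xA; apply: hg => //=; rewrite in_fsetU xA orbT.
- (* A structure for the primed names is transported back along a shift above
     all names in use, with equations tying g x to the shift of g' x. *)
  move=> GAB Dl' F' DA.
  have [n0 [nG nE ng]] := names_bound Gm E (fv A `|` fv B) g.
  set n := n0.+1 in nG nE ng.
  (* [h1] is [h] on the old names and undoes the shift on the new ones; it turns each tying equation
     into an instance of [hg]. *)
  pose k t := (t + n)%N; pose h1 t := if t < n then h t else (t - n)%N.
  have h1k t : h1 (k t) = t by rewrite /h1 /k ifN ?addnK // -leqNgt leq_addl.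
  have h1h t : t < n -> h1 t = h t by rewrite /h1 => ->.
  pose Fg := [seq (g x, k (g' x)) | x <- enum_fset (fv A `|` fv B)].
  pose F := [seq (k p.1, k p.2) | p <- F'] ++ Fg.
  have /GAB GB : forces A g (map (osubst k) Dl') F.
    apply: (IHA g' g k Dl' _ F') DA.
    + by move=> v /satisfies_cat [vF' _] p pF'; apply: (vF' (_, _)); apply: map_f.
    + by apply: matched_mapr => c v _; rewrite osubst_comp.
    + move=> v /satisfies_cat [_ vFg] x xA.
      by rewrite -(vFg (g x, k (g' x))) //; apply: map_f; rewrite in_fsetU xA.
  apply: (IHB g g' h1) GB.
  + move=> v /satisfies_cat [vE' vF']; apply/satisfies_cat; split.
      apply: satisfies_ext nE _ (hE v vE') => t tn /=.
      by rewrite h1h.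
    apply/satisfies_cat; split=> [p /mapP [q qF' ->]|p /mapP [x xAB ->]] /=.
      by rewrite !h1k; apply: vF'.
    by rewrite h1k h1h ?ng //; apply: hg.
  + apply: matched_cat.
      apply: matched_impl nG _ hG => c d nc cd v /satisfies_cat [vE' _].
      rewrite -cd //; apply: osubst_ext nc _ => t tn /=.
      by rewrite h1h.
    apply: matched_mapl => c v _; rewrite osubst_comp.
    by case: c => //= A0; congr Some; apply: subst_ext => t _ /=; rewrite h1k.
  + move=> v /satisfies_cat [vE' _] x xB.
    have xAB : x \in fv A `|` fv B by rewrite in_fsetU xB orbT.
    by rewrite h1h ?ng //; apply: hg.
- case=> y GA; exists (h y); apply: (IHA (upd g x y) _ h) GA => // v vE' z zA.
  rewrite /upd; case: (eqVneq z x) => // zx.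
  by apply: hg => //=; rewrite in_fsetD1 zx.
- move=> GA y'.
  have [n0 [nG nE ng]] := names_bound Gm E (fv A `\ x) g.
  set n := n0.+1 in nG nE ng.
  have h1h t : t < n -> upd h n y' t = h t by rewrite /upd ltn_neqAle; case: eqP.
  apply: (IHA (upd g x n) _ (upd h n y')) (GA n) => [v vE'||v vE' z zA].
  + by apply: satisfies_ext nE _ (hE v vE') => t tn /=; rewrite h1h.
  + apply: matched_impl nG _ hG => c d nc cd v vE'.
    by rewrite -cd //; apply: osubst_ext nc _ => t tn /=; rewrite h1h.
  + rewrite {2 3}/upd; case: (eqVneq z x) => [_|zx]; first by rewrite /upd eqxx.
    have zA' : z \in fv A `\ x by rewrite in_fsetD1 zx.
    by rewrite h1h ?ng //; apply: hg.
Qed.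

Lemma forces_ext A g g' Gm E : {in fv A, g =1 g'} ->
  forces A g Gm E <-> forces A g' Gm E.
Proof.
move=> gg'; have reflG : matched (agree id E) Gm Gm by apply: matched_refl.
by split; apply: (@forces_mono A _ _ id) => // v _ x xA; rewrite gg'.
Qed.

(** A substitution is absorbed by the assignment, which reduces the substitution condition of a
    model to [forces_mono]. *)
Lemma forces_subst A h g Gm E : forces (subst h A) g Gm E <-> forces A (g \o h) Gm E.
Proof.
elim: A h g Gm E => [p xs|A IHA B IHB|A IHA B IHB|x A IHA|x A IHA] h g Gm E.
- split=> GA v /GA; rewrite -[subst (v \o g) _]/(subst (v \o g) (subst h (Atom p xs)));
    by rewrite subst_comp.
- by split=> [] [Gm1 [E1 [Gm2 [E2 [? ? GA GB]]]]]; exists Gm1, E1, Gm2, E2;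
     split=> //; [apply/IHA | apply/IHB | apply/IHA | apply/IHB].
- by split=> GAB Dl F /IHA DA; apply/IHB; apply: GAB.
- set z := fresh [fset h y | y in fv A `\ x].
  have step y : forces (subst (upd h x z) A) (upd g z y) Gm E
      <-> forces A (upd (g \o h) x y) Gm E.
    rewrite IHA; apply: forces_ext => t tA; rewrite /upd /=.
    case: (eqVneq t x) => [|tx]; rewrite ?eqxx // ifN //; apply: fresh_neq.
    by apply/imfsetP; exists t => //=; rewrite in_fsetD1 tx.
  split=> -[y GA]; exists y; first exact: (proj1 (step y)).
  exact: (proj2 (step y)).
- set z := fresh [fset h y | y in fv A `\ x].
  have step y : forces (subst (upd h x z) A) (upd g z y) Gm E
      <-> forces A (upd (g \o h) x y) Gm E.
    rewrite IHA; apply: forces_ext => t tA; rewrite /upd /=.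
    case: (eqVneq t x) => [|tx]; rewrite ?eqxx // ifN //; apply: fresh_neq.
    by apply/imfsetP; exists t => //=; rewrite in_fsetD1 tx.
  split=> GA; first by move=> y; apply: (proj1 (step y)).
  by move=> /= y; apply: (proj2 (step y)).
Qed.

(** A tensor has to distribute the labels between its factors, whence several copies of [None]; the
    arbitrary [Gm] absorbs the labels added in the case of [Lolli]. *)
Lemma forces_nonempty A : exists n, forall g Gm E, forces A g (nseq n None ++ Gm) E.
Proof.
elim: A => [p xs|A [n IHA] B [m IHB]|A _ B [m IHB]|x A [n IHA]|x A [n IHA]].
- by exists 1 => g Gm E v _; left.
- exists (n + m)%N => g Gm E; exists (nseq n None ++ [::]), E, (nseq m None ++ Gm), E.
  by split=> [|v||] //; [rewrite cats0 catA nseqD | split=> [|[]]].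
- by exists m => g Gm E Dl F _; move: (IHB g (Gm ++ Dl) (E ++ F)); rewrite catA.
- by exists n => g Gm E; exists 0.
- by exists n => g Gm E y; apply: IHA.
Qed.

(* Okada's argument: a structure as strong as A on the left of a sequent
   forces A, and one that forces A derives A, without using cut. *)
Lemma forces_derives A : lolli_forall A ->
  (forall g Gm E,
     (forall v, satisfies v E -> forall Dl C,
        derives (Some (subst (v \o g) A) :: Dl) C ->
        derives (map (osubst v) Gm ++ Dl) C) ->
     forces A g Gm E) /\
  (forall g Gm E v, forces A g Gm E -> satisfies v E ->
     derives (map (osubst v) Gm) (subst (v \o g) A)).
Proof.
elim: A => //= [p xs|A IHA B IHB|x A IHA].
- move=> _; split=> [g Gm E GA v vE|g Gm E v GA]; last exact: GA.
  by rewrite -[X in derives X]cats0; apply: GA => //; right; apply: MAx.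
- case/andP=> /IHA [strongA derA] /IHB [strongB derB]; split.
    move=> g Gm E GAB Dl F DA; apply: strongB => v /satisfies_cat [vE vF] Dl' C BC.
    rewrite map_cat -catA; apply: GAB => //; apply: derives_LolliL BC.
    exact: derA DA vF.
  move=> g Gm E v GAB vE; apply: derives_LolliR.
  (* The antecedent itself, with no equations, is a structure forcing [A]; the right rule then
     discharges it. *)
  have {GAB}/GAB GB : forces A g [:: Some (subst g A)] [::].
    by apply: strongA => w _ Dl C; rewrite -subst_comp.
  have := derB _ _ _ v GB; rewrite cats0 => /(_ vE).
  rewrite map_cat /= subst_comp; apply: derives_perm.
  exact: Permutation_sym (Permutation_cons_append _ _).
- move=> /IHA [strongA derA]; split.
    move=> g Gm E GA y; apply: strongA => v vE Dl C AC; apply: GA => //=.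
    apply: (derives_AllL (y := v y)); rewrite subst1_bind ?fresh_notin //.
    rewrite (@subst_ext _ _ _ (v \o upd g x y)) // => t _.
    by rewrite /upd /=; case: ifP.
  move=> g Gm E v GA vE /=.
  set z := fresh [fset (v \o g) y | y in fv A `\ x].
  pose A' := All z (subst (upd (v \o g) x z) A).
  pose w := fresh (fvs (A' :: pmap id (map (osubst v) Gm))).
  have [n0 [nG nE ng]] := names_bound Gm E (fv A `\ x) g.
  set n := n0.+1 in nG nE ng.
  have vw t : t < n -> upd v n w t = v t by rewrite /upd ltn_neqAle; case: eqP.
  apply: (derives_AllR (z := w)); first exact: fresh_notin.
  have := derA _ _ _ (upd v n w) (GA n).
  rewrite subst1_bind ?fresh_notin // (@subst_ext _ _ _ (upd (v \o g) x w)); last first.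
    move=> t tA; rewrite /= {2}/upd {2}/upd.
    case: (eqVneq t x) => [_|tx]; first by rewrite /upd eqxx.
    by rewrite vw // ng // in_fsetD1 tx.
  rewrite (map_osubst_ext nG vw).
  by apply; apply: satisfies_ext nE _ vE => t /vw.
Qed.

End Sequents.

(** * Invariance of derivability under renaming of bound variables *)

Section Alpha.
Context {P : Type} {ar : P -> nat}.
Implicit Types (A B C : formula ar) (G D : seq (formula ar)) (h : var -> var).

Lemma fv_subst_id A : fv (subst id A) = fv A.
Proof.
rewrite fv_subst; apply/fsetP => x; apply/imfsetP/idP => /= [[y yA ->] //|xA].
by exists x.
Qed.

Lemma fvs_subst_id G : fvs (map (subst id) G) = fvs G.
Proof. by elim: G => //= A G IHG; rewrite !fvs_cons IHG fv_subst_id. Qed.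

(** Since [subst] names binders canonically, equality under [subst id] plays the role of
    alpha-equivalence. Both sides have the same renamed binder and body, and instantiating that body
    gives the two instances. *)
Lemma subst_All_inv h x z A B y : subst id (All z B) = subst h (All x A) ->
  subst1 y z B = subst (upd h x y) A.
Proof.
move=> e; pose zB := fresh [fset id y | y in fv B `\ z].
pose zA := fresh [fset h y | y in fv A `\ x].
have zz : zB = zA := congr1 (fun C => if C is All t _ then t else 0) e.
have BA : subst (upd id z zB) B = subst (upd h x zA) A :=
  congr1 (fun C => if C is All _ D then D else B) e.
rewrite -(@subst1_bind _ _ h x y zA A (fresh_notin _)) -BA -zz.
exact/esym/(@subst1_bind _ _ id)/fresh_notin.
Qed.

Lemma subst_Ex_inv h x z A B y : subst id (Ex z B) = subst h (Ex x A) ->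
  subst1 y z B = subst (upd h x y) A.
Proof.
move=> e; pose zB := fresh [fset id y | y in fv B `\ z].
pose zA := fresh [fset h y | y in fv A `\ x].
have zz : zB = zA := congr1 (fun C => if C is Ex t _ then t else 0) e.
have BA : subst (upd id z zB) B = subst (upd h x zA) A :=
  congr1 (fun C => if C is Ex _ D then D else B) e.
rewrite -(@subst1_bind _ _ h x y zA A (fresh_notin _)) -BA -zz.
exact/esym/(@subst1_bind _ _ id)/fresh_notin.
Qed.

(** The axiom rule demands identical formulae, so alpha-variants are derived by expanding the axiom.
    Induction on a common skeleton [A] with arbitrary [h] passes under binders, where an instance is
    not a subformula. *)
Lemma mill1_ax_subst A h A1 A2 :
  subst id A1 = subst h A -> subst id A2 = subst h A -> mill1 [:: A1] A2.
Proof.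
elim: A h A1 A2 => [p xs|A IHA B IHB|A IHA B IHB|x A IHA|x A IHA] h A1 A2.
- move=> e1 e2; suff -> : A1 = A2 by exact: MAx.
  case: A1 e1 => // q ys e1; case: A2 e2 => // r zs e2.
  have idE (s : P) (ws : (ar s).-tuple var) : subst id (Atom s ws) = Atom s ws.
    by congr Atom; apply: val_inj; rewrite /= map_id.
  by move: e1 e2; rewrite !idE => -> ->.
- case: A1 => //= A1 B1 [eA1 eB1]; case: A2 => //= A2 B2 [eA2 eB2].
  apply: MTensorL; apply: (@MTensorR _ _ [:: A1] [:: B1]).
    exact: IHA eA1 eA2.
  exact: IHB eB1 eB2.
- case: A1 => //= A1 B1 [eA1 eB1]; case: A2 => //= A2 B2 [eA2 eB2].
  apply: MLolliR; apply: MExch (perm_swap _ _ _) _.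
  apply: (@MLolliL _ _ [:: A2] [::]); first exact: IHA eA2 eA1.
  exact: IHB eB1 eB2.
- case: A1 => // x1 A1 e1; case: A2 => // x2 A2 e2.
  pose z := fresh (fvs [:: Ex x1 A1; Ex x2 A2]).
  apply: (MExL (z := z)); first exact: fresh_notin.
  apply: (MExR (y := z)).
  rewrite (subst_Ex_inv z e1) (subst_Ex_inv z e2).
  by apply: (IHA (upd h x z)); rewrite subst_comp.
- case: A1 => // x1 A1 e1; case: A2 => // x2 A2 e2.
  pose z := fresh (fvs [:: All x2 A2; All x1 A1]).
  apply: (MAllR (z := z)); first exact: fresh_notin.
  apply: (MAllL (y := z)).
  rewrite (subst_All_inv z e1) (subst_All_inv z e2).
  by apply: (IHA (upd h x z)); rewrite subst_comp.
Qed.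

Lemma map_eq_cat (S T : Type) (f : S -> T) s s1 s2 : map f s = map f (s1 ++ s2) ->
  exists s1' s2', [/\ s = s1' ++ s2', map f s1' = map f s1 & map f s2' = map f s2].
Proof.
elim: s1 s => [|a s1 IHs1] [|b s] //=; try by exists [::], s2.
  by move=> e; exists [::], [::].
  by move=> e; exists [::], (b :: s).
case=> eab /IHs1 [s1' [s2' [-> e1 e2]]].
by exists (b :: s1'), s2'; rewrite /= eab e1.
Qed.

(** Each rule is replayed on the variants: [subst id] preserves the outermost connective and the
    free variables, hence the eigenvariable conditions. *)
Lemma mill1_alpha G B : mill1 G B -> forall G' B',
  map (subst id) G' = map (subst id) G -> subst id B' = subst id B -> mill1 G' B'.
Proof.
elim=> {G B}.
- move=> G D C permGD _ IH D' C' eD eC.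
  have : Permutation (map (subst id) G) (map (subst id) D').
    by rewrite eD; apply: Permutation_map.
  case/Permutation_map_inv => G' [eG permG'].
  by apply: MExch (Permutation_sym permG') _; apply: IH.
- by move=> A [|A' []] // B' [eA] eB; apply: mill1_ax_subst eA eB.
- move=> G A B C _ IH [|[]] //= A' B' G' C' [eA eB eG] eC.
  by apply: MTensorL; apply: IH => //=; rewrite eA eB eG.
- move=> G D A B _ IHA _ IHB G' B' /map_eq_cat [G1 [G2 [-> eG1 eG2]]].
  by case: B' => //= A' B' [eA eB]; apply: MTensorR; [apply: IHA | apply: IHB].
- move=> G D A B C _ IHA _ IHC [|[]] //= A' B' G' C' [eA eB].
  case/map_eq_cat => [G1 [G2 [-> eG1 eG2]]] eC.
  by apply: MLolliL; [apply: IHA | apply: IHC => //=; rewrite eB eG2].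
- move=> G A B _ IH G' [] //= A' B' eG [eA eB].
  by apply: MLolliR; apply: IH => //=; rewrite eA eG.
- move=> G x z A C z_fresh _ IH [|A0 G'] // C' [eA eG] eC.
  case: A0 eA => // x' A' eA.
  have {}eA : subst id (Ex x' A') = subst id (Ex x A) := eA.
  apply: (MExL (z := z)).
    by rewrite -fvs_subst_id !map_cons eA eC eG -!map_cons fvs_subst_id.
  by apply: IH => //=; rewrite (subst_Ex_inv z eA) eG.
- move=> G x y A _ IH G' [] // x' A' eG eA; apply: (MExR (y := y)).
  by apply: IH => //; rewrite (subst_Ex_inv y eA).
- move=> G x y A C _ IH [|A0 G'] // C' [eA eG] eC.
  case: A0 eA => // x' A' eA.
  have {}eA : subst id (All x' A') = subst id (All x A) := eA.
  by apply: (MAllL (y := y)); apply: IH => //=; rewrite (subst_All_inv y eA) eG.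
- move=> G x z A z_fresh _ IH G' [] // x' A' eG eA.
  apply: (MAllR (z := z)).
    by rewrite -fvs_subst_id map_cons eA eG -map_cons fvs_subst_id.
  by apply: IH => //; rewrite (subst_All_inv z eA).
Qed.

Lemma mill1_subst_id G B : mill1 (map (subst id) G) (subst id B) -> mill1 G B.
Proof.
move/mill1_alpha; apply; last by rewrite subst_comp.
by rewrite -map_comp; apply: eq_map => A /=; rewrite subst_comp.
Qed.

End Alpha.

(** * Hypergraphs without internal nodes *)

Section PermutationEq.
Context {T : eqType}.
Implicit Types (s t : seq T).

Lemma perm_eq_Permutation s t : perm_eq s t -> Permutation s t.
Proof.
elim: s t => [|a s IHs] t permst.
  by move/perm_size/esym/size0nil: permst => ->.
have ta : a \in t by rewrite -(perm_mem permst) mem_head.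
case/splitPr: t / ta permst => t1 t2 permst.
apply: Permutation_cons_app; apply: IHs.
by move: permst; rewrite perm_sym -cat1s perm_catCA perm_cons perm_sym.
Qed.

Lemma Permutation_perm_eq s t : Permutation s t -> perm_eq s t.
Proof.
elim=> //= [a s' t' _ IH|a b s'|s1 s2 s3 _ IH1 _ IH2].
- by rewrite perm_cons.
- by rewrite -[[:: b, a & s']]/([:: b] ++ [:: a] ++ s') perm_catCA.
- exact: seq.perm_trans IH1 IH2.
Qed.

End PermutationEq.

Lemma Permutation_enum (T : finType) (l : seq T) :
  uniq l -> (forall e, e \in l) -> Permutation (enum T) l.
Proof.
move=> uniq_l all_l; apply: perm_eq_Permutation; apply: uniq_perm => // [|e].
  exact: enum_uniq.
by rewrite mem_enum all_l.
Qed.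

Lemma matched_mapR (S T U : Type) (R : S -> T -> Prop) (R' : S -> U -> Prop)
    (g : T -> U) s t :
  (forall a b, R a b -> R' a (g b)) -> matched R s t -> matched R' s (map g t).
Proof.
move=> RR' [t' permt Rst]; exists (map g t'); first exact: Permutation_map.
by elim: Rst => {s t t' permt}; constructor; auto.
Qed.

Lemma matched_unmapR (S T U : Type) (R : S -> U -> Prop) (g : T -> U) s t :
  matched R s (map g t) -> matched (fun a b => R a (g b)) s t.
Proof.
case=> t' /Permutation_sym/Permutation_map_inv [u [-> permu]] Rsu.
exists u => //; elim: s u {permu} Rsu => [|a s IHs] [|c u] Rsu;
  inversion Rsu; constructor=> //; exact: IHs.
Qed.

Lemma fin_bij (A B : finType) (g : A -> B) :
  injective g -> (forall b, exists a, g a = b) ->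
  exists g', cancel g g' /\ cancel g' g.
Proof.
move=> inj_g /fin_all_exists [g' g'K]; exists g'; split=> // a.
by apply: inj_g; rewrite g'K.
Qed.

Section GoodHypergraphs.
Context {T : Type} {ty : T -> {fset var}}.
Implicit Types (H K : hypergraph ty).

Definition all_external H := forall w : hnode H, exists s, ext_at s w.

Lemma all_external_iso H K : hiso H K -> all_external H -> all_external K.
Proof.
case/hiso_elim=> f [f' [_ [_ [[_ f'K] _ [_ _ extf _]]]]] goodH w.
by have [s sw] := goodH (f' w); exists s; rewrite -[w]f'K; apply: extf.
Qed.

Lemma all_external_par H K :
  all_external H -> all_external K -> all_external (hpar H K).
Proof.
move=> goodH goodK w; case: (par_nodeP w) => [] [v ->].
  by have [s sv] := goodH v; exists s; apply: ext_at_inl.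
by have [s sv] := goodK v; exists s; apply: ext_at_inr.
Qed.

(* An internal node stays internal, and alone in its class, in a parallel
   composition. *)
Lemma all_external_parl H K : all_external (hpar H K) -> all_external H.
Proof.
move=> good v; case: (boolP [exists s, hext s == v]) => [/existsP [s /eqP <-]|int_v].
  by exists (val s); apply: hext_at.
pose f (a : hnode H + hnode K) := if a is inl u then u == v else false.
have fr a b : par_rel a b -> f a = f b.
  case: a b => [u|u] [] // w /par_relP [s [[i def_u] _]] /=.
  by apply: contraNF int_v => /eqP <-; apply/existsP; exists [` i]; rewrite def_u.
have [s /ext_at_par [[u su]|[u su]]] := good (inl_par K v).
  by move/(inquot_invariant fr) => /=; rewrite eqxx => /esym/eqP <-; exists s.
by move/(inquot_invariant fr) => /=; rewrite eqxx.
Qed.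

Section Restriction.
Context (H : hypergraph ty).

(** All nodes and external names are kept, so that the restriction satisfies the same equations as
    [H]. *)
Definition hrestr (l : seq (hedge H)) : hypergraph ty :=
  @Hypergraph T ty (hnode H) {e : hedge H | e \in l} (fun e => hlab (val e))
    (fun e => @hatt _ _ H (val e)) (htype H) (@hext _ _ H).

(** Every node is external, so its two copies are fused again; an internal node would be
    duplicated. *)
Lemma hrestr_par l1 l2 : all_external H -> Permutation (enum (hedge H)) (l1 ++ l2) ->
  hiso (hpar (hrestr l1) (hrestr l2)) H.
Proof.
move=> goodH /Permutation_perm_eq permE.
have mem_l e : (e \in l1) || (e \in l2).
  by rewrite -mem_cat -(perm_mem permE) mem_enum.
have disj e : e \in l1 -> e \notin l2.
  have := enum_uniq (hedge H); rewrite (perm_uniq permE) cat_uniq.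
  by case/and3P => _ /hasPn dis _ el1; apply/negP => /dis; rewrite el1.
have [s v w sv sw|f [fl fr]] := @par_lift _ _ (hrestr l1) (hrestr l2) (hnode H) id id.
  exact: ext_at_fun sv sw.
have extf s w : @ext_at _ _ (hpar (hrestr l1) (hrestr l2)) s w -> @ext_at _ _ H s (f w).
  by case/ext_at_par => [] [v sv ->]; rewrite ?fl ?fr.
pose i1 : hnode H -> _ := @inl_par _ _ (hrestr l1) (hrestr l2).
have i1E w : w = i1 (f w).
  case: (par_nodeP w) => [] [v ->]; rewrite ?fl ?fr // /i1.
  by have [s sv] := goodH v; apply/esym/(par_fuse (s := s)).
pose g (e : hedge (hpar (hrestr l1) (hrestr l2))) : hedge H :=
  match e with inl e => val e | inr e => val e end.
have [||g' [gK g'K]] := @fin_bij _ _ g.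
- move=> [] e1 [] e2 /= e12.
  + by congr inl; apply: val_inj.
  + by have /negP [] := disj _ (valP e1); rewrite /= e12; apply: (valP e2).
  + by have /negP [] := disj _ (valP e2); rewrite /= -e12; apply: (valP e1).
  + by congr inr; apply: val_inj.
- move=> e; case/orP: (mem_l e) => el.
    by exists (inl (exist _ e el)).
  by exists (inr (exist _ e el)).
apply: (@hiso_intro _ _ _ H f i1 g g') => //.
- by case.
- case=> e s w.
    by case/att_at_parl => v sv ->; rewrite fl.
  by case/att_at_parr => v sv ->; rewrite fr.
- by move=> s w sw; apply: ext_at_inl.
Qed.

End Restriction.

(** * Fusion of external nodes by a substitution *)

Section SubProperties.
Context (h : var -> var) (H : hypergraph ty).

Definition sub_node (v : hnode H) : hnode (hsub h H) := inquot (@sub_rel _ _ h H) v.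

Lemma sub_nodeP (w : hnode (hsub h H)) : exists v, w = sub_node v.
Proof. by exists (qrep w); rewrite /sub_node qrepK. Qed.

Lemma sub_fuse s s' v v' : h s = h s' -> ext_at s v -> ext_at s' v' ->
  sub_node v = sub_node v'.
Proof.
move=> hs [i <-] [i' <-]; apply: inquot_rel; apply/existsP; exists [` i].
by apply/existsP; exists [` i']; rewrite /= hs !eqxx.
Qed.

Lemma sub_lift (W : Type) (f : hnode H -> W) :
  (forall s s' v v', h s = h s' -> ext_at s v -> ext_at s' v' -> f v = f v') ->
  exists F : hnode (hsub h H) -> W, forall v, F (sub_node v) = f v.
Proof.
move=> fh; apply: quot_lift => v v' /existsP [s /existsP [s' /and3P [/eqP hs]]].
by move=> /eqP <- /eqP <-; apply: fh hs _ _; apply: hext_at.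
Qed.

Lemma ext_at_sub t w : @ext_at _ _ (hsub h H) t w <->
  exists s v, [/\ ext_at s v, t = h s & w = sub_node v].
Proof.
split=> [[i <-]|[s [v [sv -> ->]]]].
  exists (val (xchoose (sub_preim [` i]))), (hext (xchoose (sub_preim [` i]))).
  by split=> //; [exact: hext_at | rewrite (eqP (xchooseP (sub_preim [` i])))].
have j : h s \in htype (hsub h H).
  by apply/imfsetP; exists s => //=; apply: ext_at_type sv.
exists j; apply: (sub_fuse (s := val (xchoose (sub_preim [` j]))) (s' := s)) => //.
  exact: (eqP (xchooseP (sub_preim [` j]))).
exact: hext_at.
Qed.

Lemma all_external_sub : all_external H -> all_external (hsub h H).
Proof.
move=> goodH w; have [v ->] := sub_nodeP w; have [s sv] := goodH v.
by exists (h s); apply/ext_at_sub; exists s, v.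
Qed.

End SubProperties.

End GoodHypergraphs.

(** * The canonical model *)

Lemma Forall_nth (S : Type) (Q : S -> Prop) x0 (s : seq S) i :
  List.Forall Q s -> i < size s -> Q (nth x0 s i).
Proof. by move=> Qs; elim: Qs i => // a {}s Qa _ IHs [|i] //=; apply: IHs. Qed.

Section CanonicalModel.
Context {P : Type} {ar : P -> nat}.
Implicit Types (A B C : formula ar) (Gm Dl : seq (option (formula ar))).
Implicit Types (E F : seq (var * var)) (v g h : var -> var).

Notation hgraph := (hypergraph (@label_fv P ar)).
Implicit Types (H K : hgraph).

(* The value 0 is junk: only the variables in label_fv (hlab e) matter. *)
Definition att_val H (n : hnode H -> var) (e : hedge H) : var -> var := fun s =>
  if insub s is Some i then n (@hatt _ _ H e i) else 0.

Definition edge_formula H (n : hnode H -> var) (e : hedge H) :=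
  osubst (att_val n e) (hlab e).

Lemma osubst_in h g (c : option (formula ar)) :
  {in label_fv c, h =1 g} -> osubst h c = osubst g c.
Proof. by case: c => //= A hg; congr Some; apply: subst_ext. Qed.

Lemma att_valE H n (e : hedge H) s w : att_at e s w -> att_val n e s = n w.
Proof.
case=> i <-; rewrite /att_val insubT; congr (n (hatt _)); exact: val_inj.
Qed.

Lemma att_total H (e : hedge H) s : s \in label_fv (hlab e) -> exists w, att_at e s w.
Proof. by move=> i; exists (hatt [` i]); exists i. Qed.

Lemma edge_formulaE H (n : hnode H -> var) (e : hedge H) v c :
  hlab e = c ->
  (forall s w, att_at e s w -> n w = v s) -> edge_formula n e = osubst v c.
Proof.
move=> <- nv; apply: osubst_in => s /att_total [w sw].
by rewrite (att_valE _ sw) (nv s).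
Qed.

Lemma edge_formula_morph H K (f : hnode H -> hnode K) (n : hnode K -> var) e e' :
  hlab e' = hlab e -> (forall s w, att_at e s w -> att_at e' s (f w)) ->
  edge_formula n e' = edge_formula (n \o f) e.
Proof.
move=> lab attf; rewrite /edge_formula lab; apply: osubst_in => s.
by case/att_total => w sw; rewrite (att_valE _ sw) (att_valE _ (attf _ _ sw)).
Qed.

(** For a given [v] such an [n] exists exactly when [v] is constant on the selectors of each
    node. *)
Definition valuation H (n : hnode H -> var) v := forall s w, ext_at s w -> n w = v s.

(* (Gm, E) describes H: E generates the equalities between selectors imposed by
   H, and Gm lists the edge labels with their attachments named by selectors. *)
Definition describes H Gm E :=
  [/\ all_external H,
      forall v, satisfies v E <-> exists n, @valuation H n v &
      matched (fun c e => forall n v, @valuation H n v -> osubst v c = edge_formula n e)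
        Gm (enum (hedge H))].

Lemma describes_iso H K Gm E : hiso H K -> describes H Gm E -> describes K Gm E.
Proof.
move=> isoHK [goodH satH edgeH]; split; first exact: all_external_iso isoHK goodH.
  move=> v; rewrite satH; have := hiso_elim isoHK.
  case=> f [f' [_ [_ [[fK f'K] _ [_ _ extf extf']]]]].
  split=> [] [n nv]; first by exists (n \o f') => s w /extf'; apply: nv.
  by exists (n \o f) => s w /extf; apply: nv.
have [f [f' [g [g' [[fK f'K] [gK g'K] [labg attg extf extf']]]]]] := hiso_elim isoHK.
apply: (@matched_permr _ _ _ _ (map g (enum (hedge H)))).
  apply: Permutation_sym; apply: Permutation_enum => [|e].
    by rewrite map_inj_uniq ?enum_uniq //; apply: can_inj gK.
  by rewrite -[e]g'K map_f ?mem_enum.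
apply: matched_mapR edgeH => c e ce n v nv.
rewrite (@edge_formula_morph _ _ (f) n e) //; last exact: attg.
by apply: ce => s w /extf; apply: nv.
Qed.

(** Valuations of [H] and [K] along the same [v] agree on fused nodes and glue together, so the
    equations are simply concatenated. *)
Lemma describes_par H K Gm Dl E F :
  describes H Gm E -> describes K Dl F -> describes (hpar H K) (Gm ++ Dl) (E ++ F).
Proof.
move=> [goodH satH edgeH] [goodK satK edgeK]; split.
- exact: all_external_par.
- move=> v; rewrite satisfies_cat satH satK; split=> [[[n nv] [m mv]]|[n nv]].
    have [s u w su sw|f [fl fr]] := @par_lift _ _ H K _ n m.
      by rewrite (nv _ _ su) (mv _ _ sw).
    by exists f => s w /ext_at_par [] [u su ->]; rewrite ?fl ?fr; [apply: nv | apply: mv].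
  split; [exists (n \o @inl_par _ _ H K) | exists (n \o @inr_par _ _ H K)] => s w sw.
    by apply: nv; apply: ext_at_inl.
  by apply: nv; apply: ext_at_inr.
- apply: (@matched_permr _ _ _ _ (map inl (enum (hedge H)) ++ map inr (enum (hedge K)))).
    apply: Permutation_sym; apply: Permutation_enum => [|e].
      rewrite cat_uniq (map_inj_uniq (@inl_inj _ _)) (map_inj_uniq (@inr_inj _ _)).
      rewrite !enum_uniq andbT; apply/hasPn => _ /mapP [e _ ->].
      by apply/mapP => [[]].
    rewrite mem_cat; case: e => e; apply/orP; [left | right];
      by rewrite map_f ?mem_enum.
  apply: matched_cat.
    apply: matched_mapR edgeH => c e ce n v nv.
    rewrite (@edge_formula_morph _ _ (@inl_par _ _ H K) n e) //; last first.
      by move=> s w; apply: att_at_inl.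
    by apply: ce => s w sw; apply: nv; apply: ext_at_inl.
  apply: matched_mapR edgeK => c e ce n v nv.
  rewrite (@edge_formula_morph _ _ (@inr_par _ _ H K) n e) //; last first.
    by move=> s w; apply: att_at_inr.
  by apply: ce => s w sw; apply: nv; apply: ext_at_inr.
Qed.

(** A valuation of the fused hypergraph along [v] amounts to one of [H] along [v \o h]. *)
Lemma describes_sub h H Gm E : describes H Gm E ->
  describes (hsub h H) (map (osubst h) Gm) [seq (h p.1, h p.2) | p <- E].
Proof.
move=> [goodH satH edgeH]; split; first exact: all_external_sub.
  move=> v; have -> : satisfies v [seq (h p.1, h p.2) | p <- E] <-> satisfies (v \o h) E.
    split=> vE p pE; last by case/mapP: pE => q qE ->; apply: vE.
    by apply: (vE (_, _)); apply: map_f.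
  rewrite satH; split=> [] [n nv].
    have [s s' w w' hs sw sw'|f fE] := @sub_lift _ _ h H _ n.
      by rewrite (nv _ _ sw) (nv _ _ sw') /= hs.
    by exists f => t w /ext_at_sub [s [u [su -> ->]]]; rewrite fE; apply: nv.
  exists (n \o @sub_node _ _ h H) => s w sw; apply: nv.
  by apply/ext_at_sub; exists s, w.
apply: matched_flip; apply: matched_mapR (matched_flip edgeH) => e d de n v nv.
rewrite osubst_comp (de (n \o @sub_node _ _ h H)) => [|s w sw]; last first.
  by apply: nv; apply/ext_at_sub; exists s, w.
by apply/esym/edge_formula_morph => // s w [i <-]; exists i.
Qed.

Lemma describes_restr H Gm E Dl (l : seq (hedge H)) : describes H Gm E -> uniq l ->
  matched (fun c e => forall n v, @valuation H n v -> osubst v c = edge_formula n e) Dl l ->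
  describes (hrestr l) Dl E.
Proof.
move=> [goodH satH _] uniq_l edge_l; split=> //.
apply: (@matched_unmapR _ _ _ (fun c (e : hedge H) => forall n v,
  @valuation H n v -> osubst v c = edge_formula n e) val).
apply: matched_permr edge_l.
apply: perm_eq_Permutation; apply: uniq_perm => // [|e].
  by rewrite map_inj_uniq ?enum_uniq //; apply: val_inj.
apply/idP/mapP => [el|[e' _ ->]]; last exact: (valP e').
by exists (exist _ e el); rewrite ?mem_enum.
Qed.

Lemma describes_exists H : all_external H -> exists Gm E, describes H Gm E.
Proof.
(* [nm] names each node by one of its selectors; [E] then lists all pairs of selectors sharing a
   node. *)
move=> goodH; have /fin_all_exists [nm nmP] := goodH.
pose E := [seq (val p.1, val p.2) |
            p <- enum {: htype H * htype H} & hext p.1 == hext p.2].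
have EP v : satisfies v E -> forall s w, ext_at s w -> v (nm w) = v s.
  move=> vE s w [i sw]; have [j nmw] := nmP w.
  apply: (vE (nm w, s)); apply/mapP; exists ([` j], [` i]) => //.
  by rewrite mem_filter mem_enum andbT /= nmw sw.
exists (map (edge_formula nm) (enum (hedge H))), E; split=> //.
  move=> v; split=> [vE|[n nv] p].
    by exists (v \o nm) => s w sw; apply: EP sw.
  case/mapP=> [] [s s']; rewrite mem_filter => /andP [/eqP /= ss' _] -> /=.
  by rewrite -(nv _ _ (hext_at s)) -(nv _ _ (hext_at s')) ss'.
apply: matched_mapl => e n v nv; rewrite /edge_formula osubst_comp.
apply: osubst_in => s /att_total [w sw] /=.
by rewrite !(att_valE _ sw) (nv (nm w)).
Qed.

Lemma describes_realize Gm E : exists H, describes H Gm E.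
Proof.
have [n [nG nE _]] := names_bound Gm E fset0 id.
pose r : rel 'I_n.+1 := fun a b => (nat_of_ord a, nat_of_ord b) \in E.
(* Nodes are classes of names up to [n], all of which become selectors. Beyond [n], [inord] yields
   0, but no such name occurs in [Gm] or [E]. *)
pose node (s : var) := inquot r (inord s).
pose H : hgraph := @Hypergraph _ label_fv (quot r) 'I_(size Gm)
  (tnth (in_tuple Gm)) (fun e s => node (val s))
  [fset x | x in iota 0 n.+1] (fun s => node (val s)).
have mem_typeH s : (s \in htype H) = (s < n.+1).
  apply/imfsetP/idP => [[x + ->]|sn]; first by rewrite -[_ \in _]/(x \in iota 0 n.+1) mem_iota.
  by exists s => //; rewrite -[_ \in _]/(s \in iota 0 n.+1) mem_iota.
have extH s w : @ext_at _ _ H s w <-> s < n.+1 /\ w = node s.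
  rewrite -mem_typeH; split=> [[i <-] //|[i ->]]; by exists i.
exists H; split.
- move=> w; exists (val (qrep w)); apply/extH; split; first exact: ltn_ord.
  by rewrite /node inord_val qrepK.
- move=> v; split=> [vE|[f fv] p pE].
    have [a b ab|f fE] := @quot_lift _ r _ (v \o @nat_of_ord _).
      exact: vE ab.
    by exists f => s w /extH [sn ->]; rewrite fE /= inordK.
  have [p1 p2] := nE p pE.
  have -> : v p.1 = f (node p.1) by rewrite (fv p.1) //; apply/extH.
  have -> : v p.2 = f (node p.2) by rewrite (fv p.2) //; apply/extH.
  congr (f _); apply: inquot_rel; rewrite /r !inordK //.
  by case: p pE {p1 p2}.
have -> : Gm = map (tnth (in_tuple Gm)) (enum 'I_(size Gm)) by rewrite map_tnth_enum.
apply: matched_mapl => e f v fv; apply/esym/edge_formulaE => // s w [i <-] /=.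
apply: fv; apply/extH; split=> //.
apply: (Forall_nth None nG (ltn_ord e)); move: i.
by rewrite -[hlab e]/(tnth (in_tuple Gm) e) (tnth_nth None).
Qed.

Lemma describes_agree H Gm E Gm' E' : describes H Gm E -> describes H Gm' E' ->
  (forall v, satisfies v E' -> satisfies v E) /\ matched (agree id E') Gm Gm'.
Proof.
move=> [_ satH edgeH] [_ satH' edgeH']; split=> [v /satH' /satH //|].
apply: matched_sub (matched_comp edgeH (matched_flip edgeH')) => c d [e ce de] v.
by case/satH' => n nv; rewrite (de n v nv) -(ce n v nv).
Qed.

(** Forcing depends on the hypergraph alone and not on the chosen description. *)
Lemma describes_forces H Gm E Gm' E' A g : describes H Gm E -> describes H Gm' E' ->
  forces A g Gm E -> forces A g Gm' E'.
Proof.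
move=> H1 H2; have [sub_E agr] := describes_agree H1 H2.
exact: (forces_mono (h := id)).
Qed.

Definition can_val A H := exists Gm E, describes H Gm E /\ forces A id Gm E.

Lemma can_valE H Gm E A : describes H Gm E -> can_val A H <-> forces A id Gm E.
Proof.
move=> dH; split=> [[Gm' [E' [dH' AH]]]|AH]; last by exists Gm, E.
exact: describes_forces dH' dH AH.
Qed.

Lemma can_val_iso A H K : hiso H K -> can_val A H -> can_val A K.
Proof.
by move=> isoHK [Gm [E [dH AH]]]; exists Gm, E; split=> //; apply: describes_iso dH.
Qed.

Lemma can_val_sub h A H : can_val A H -> can_val (subst h A) (hsub h H).
Proof.
case=> Gm [E [dH AH]]; exists (map (osubst h) Gm), [seq (h p.1, h p.2) | p <- E].
split; first exact: describes_sub.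
apply/forces_subst; apply: (forces_mono (h := h)) AH => //.
  by move=> v vE p pE; apply: (vE (_, _)); apply: map_f.
by apply: matched_mapr => c v _; rewrite osubst_comp.
Qed.

Lemma can_val_tensor A B H :
  can_val (Tensor A B) H <-> lpar (can_val A) (can_val B) H.
Proof.
split=> [[Gm [E [dH /= [Gm1 [E1 [Gm2 [E2 [permG E12 AG BG]]]]]]]]|].
  have [goodH satH edgeH] := dH.
  have [l1 [l2 [perm_l edge1 edge2]]] := matched_split (matched_perml permG edgeH).
  have := enum_uniq (hedge H); rewrite (perm_uniq (Permutation_perm_eq perm_l)).
  rewrite cat_uniq => /and3P [uniq1 _ uniq2].
  exists (hrestr l1), (hrestr l2); split; last exact: hrestr_par.
    (* The restriction keeps every node and is thus described by all of [E], which entails [E1]. *)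
    exists Gm1, E; split; first exact: (describes_restr dH).
    apply: (forces_mono (h := id)) AG => //; first by move=> v /E12 [].
    exact: matched_refl.
  exists Gm2, E; split; first exact: (describes_restr dH uniq2 edge2).
  apply: (forces_mono (h := id)) BG => //; first by move=> v /E12 [].
  exact: matched_refl.
case=> H1 [H2 [[Gm1 [E1 [d1 AG]]] [Gm2 [E2 [d2 BG]]] isoH]].
exists (Gm1 ++ Gm2), (E1 ++ E2); split.
  by apply: describes_iso isoH _; apply: describes_par.
exists Gm1, E1, Gm2, E2; split=> // v; exact: satisfies_cat.
Qed.

Lemma can_val_lolli A B H :
  can_val (Lolli A B) H <-> forall K, can_val A K -> can_val B (hpar H K).
Proof.
split=> [[Gm [E [dH AB]]] K [Dl [F [dK AK]]]|AB].
  exists (Gm ++ Dl), (E ++ F); split; first exact: describes_par.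
  exact: AB.
(* A member [K0] of the value of [A] puts [hpar H K0] in the value of [B], which excludes internal
   nodes in [H]. Only then does [H] have a description. *)
have [m Am] := forces_nonempty A.
have [K0 dK0] := describes_realize (nseq m None ++ [::]) [::].
have /AB [_ [_ [[good _ _] _]]] : can_val A K0 by apply/(can_valE _ dK0).
have [Gm [E dH]] := describes_exists (all_external_parl good).
(* Forcing quantifies over pairs and the model over hypergraphs; realizing each pair bridges the
   two. *)
exists Gm, E; split=> // Dl F AD; have [K dK] := describes_realize Dl F.
by apply/(can_valE _ (describes_par dH dK)); apply: AB; apply/(can_valE _ dK).
Qed.

Lemma forces_subst1 x y A Gm E :
  forces (subst1 y x A) id Gm E <-> forces A (upd id x y) Gm E.
Proof. exact: forces_subst. Qed.

Lemma can_val_ex x A H :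
  can_val (Ex x A) H <-> exists y, can_val (subst1 y x A) H.
Proof.
split=> [[Gm [E [dH [y AH]]]]|[y [Gm [E [dH AH]]]]].
  by exists y, Gm, E; split=> //; apply/forces_subst1.
by exists Gm, E; split=> //; exists y; apply/forces_subst1.
Qed.

Lemma can_val_all x A H :
  can_val (All x A) H <-> forall y, can_val (subst1 y x A) H.
Proof.
split=> [[Gm [E [dH AH]]] y|AH].
  by exists Gm, E; split=> //; apply/forces_subst1; apply: AH.
(* The instance at 0 merely provides a description, which serves for all instances. *)
have [Gm [E [dH _]]] := AH 0; exists Gm, E; split=> // y.
by apply/forces_subst1/(can_valE _ dH).
Qed.

Definition canonical_model : hmodel ar :=
  HModel can_val_iso can_val_sub can_val_tensor can_val_lolli can_val_ex can_val_all.

(** The first half of [forces_derives] places each antecedent, taken as a single edge, in its own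
    value; their parallel composition tests the truth of the sequent. *)
Lemma canonical_ctxval (G : seq (formula ar)) : all (@lolli_forall P ar) G ->
  exists H, @ctxval _ _ canonical_model G H /\ describes H (map Some G) [::].
Proof.
elim: G => [_|A G IHG /= /andP [fragA /IHG [H [GH dH]]]].
  exists (hempty _); split; first exact: hiso_refl.
  split; first by case.
    by move=> v; split=> // _; exists (fun w : void => match w with end) => s [].
  by exists [::]; [case: (enum _) => [|[]] | constructor].
have [K dK] := describes_realize [:: Some A] [::].
exists (hpar K H); split; last exact: describes_par dK dH.
exists K, H; split=> //; last exact: hiso_refl.
exists [:: Some A], [::]; split=> //.
by apply: (forces_derives fragA).1.
Qed.

Lemma completeness (G : seq (formula ar)) B :
  all (@lolli_forall P ar) G -> lolli_forall B ->
  true_in canonical_model G B -> mill1 G B.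
Proof.
move=> fragG fragB /true_inE GB; have [H [/GB BH dH]] := canonical_ctxval fragG.
have {}BH : forces B id (map Some G) [::] by apply/(can_valE _ dH).
have := (forces_derives fragB).2 _ _ _ id BH => /(_ (fun _ => ltac:(done))).
(* No label is [None], so the derivation is genuine. It concerns the formulae with binders renamed
   by [subst id], which [mill1_subst_id] undoes. *)
case=> [|GB']; first by rewrite -map_comp all_map /= all_predT.
apply: mill1_subst_id; move: GB'.
suff -> : pmap id (map (osubst id) (map Some G)) = map (subst id) G by [].
by elim: (G) => //= A G' ->.
Qed.

End CanonicalModel.

Theorem theorem35 (P : Type) (ar : P -> nat) :
  (forall (G : seq (formula ar)) (B : formula ar),
     mill1 G B -> forall M : hmodel ar, true_in M G B) /\
  (forall (G : seq (formula ar)) (B : formula ar),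
     all (@lolli_forall P ar) G -> lolli_forall B ->
     (forall M : hmodel ar, true_in M G B) -> mill1 G B).
Proof.
split=> [G B GB M|G B fragG fragB GB]; first exact: soundness.
exact: completeness.
Qed.
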